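(* Let $X$ be the Cantor set and let $G\curvearrowright X$ be a strictly ergodic action by homeomorphisms of a countable discrete group $G$ with dynamical comparison. Let $\mu$ be the unique invariant Borel probability measure, $E:C(X)\rtimes_\lambda G\to C(X)$ the canonical conditional expectation, and $\tau=\mu\circ E$. Then $(E,\tau)$ has norm averaging.
   Context: An action $G\curvearrowright X$ on the Cantor set is *strictly ergodic* if it is minimal and uniquely ergodic (has exactly one invariant Borel probability measure). $M_G(X)$ denotes the set of $G$-invariant Borel probability measures. *Dynamical comparison.* For clopen $U,V\subseteq X$ write $U\prec_G V$ if there is a finite clopen partition $U=\bigsqcup_j U_j$ and elements $g_j\in G$ such that the sets $g_jU_j$ are pairwise disjoint subsets of $V$. The action has dynamical comparison if $U\prec_G V$ whenever $U,V\subseteq X$ are clopen and $\mu(U)<\mu(V)$ for every $\mu\in M_G(X)$. *Crossed product.* $C(X)\rtimes_\lambda G$ is the reduced crossed product, generated by $C(X)$ and unitaries $u_g$ with $u_gfu_g^*=\alpha_g f$, $\alpha_gf(x)=f(g^{-1}x)$; the canonical faithful conditional expectation satisfies $E(\sum_g f_gu_g)=f_e$ on finite sums. An invariant probability measure $\mu$ is viewed as a tracial state $\mu(f)=\int f\,d\mu$ on $C(X)$. *Norm averaging.* Let $E:A\to D$ be a faithful conditional expectation and $\tau=\sigma\circ E$ a faithful tracial state. Then $(E,\tau)$ has norm averaging if, for every finite $F\subset A$ and $\varepsilon>0$, there is a unitary $w\in A$ such that $\|E(w^*xw)-\tau(x)1\|<\varepsilon$ for all $x\in F$. *)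

(* Defs.v *)
From HB Require Import structures.
From mathcomp Require Import all_boot all_order all_algebra.
From mathcomp Require Import complex finmap.
From mathcomp Require Import all_classical all_reals all_analysis.
From mathcomp Require Import summability.
From mathcomp Require Import ring lra.

Set Implicit Arguments.
Unset Strict Implicit.
Unset Printing Implicit Defensive.
Import Order.TTheory GRing.Theory Num.Theory.
Import numFieldNormedType.Exports.

Local Open Scope classical_set_scope.
Local Open Scope ring_scope.
Local Open Scope complex_scope.

(* The norm of R[i] takes its values in R[i]; modulus is its real version. *)
Definition modulus (R : realType) (z : R[i]) : R := complex.Re `|z|.

Section Modulus.
Context {R : realType}.
Implicit Types z : R[i].

Lemma modulusE z : (modulus z)%:C = `|z|.
Proof. by rewrite /modulus normc_def. Qed.

Lemma modulus_ge0 z : 0 <= modulus z.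
Proof. by rewrite -lecR modulusE normr_ge0. Qed.

Lemma modulus0 : modulus (0 : R[i]) = 0.
Proof. by rewrite /modulus normr0. Qed.

Lemma modulusM z1 z2 : modulus (z1 * z2) = modulus z1 * modulus z2.
Proof. by apply: complexI; rewrite rmorphM /= !modulusE normrM. Qed.

Lemma ler_modulusD z1 z2 : modulus (z1 + z2) <= modulus z1 + modulus z2.
Proof. by rewrite -lecR rmorphD /= !modulusE ler_normD. Qed.

End Modulus.

Section SquareSummable.
Context {R : realType} {I : choiceType}.
Implicit Types (a : R) (f g : I -> R[i]).

Definition sqsum f : \bar R :=
  (\esum_(i in [set: I]) (modulus (f i) ^+ 2)%:E)%E.

Definition square_summable : {pred (I -> R[i])} := [pred f | (sqsum f < +oo)%E].

Lemma square_summable_le a f g :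
    (forall i, modulus (g i) <= a * modulus (f i)) ->
  f \in square_summable -> g \in square_summable.
Proof.
move=> gf; rewrite !inE => fS.
have ge0 (h : I -> R[i]) i : (0 <= (modulus (h i) ^+ 2)%:E)%E.
  by rewrite lee_fin exprn_ge0 ?modulus_ge0.
apply: (@le_lt_trans _ _ ((a ^+ 2)%:E * sqsum f)%E); last first.
  have := esum_ge0 (fun i (_ : [set: I] i) => ge0 f i).
  rewrite -/(sqsum f); move: fS; case: (sqsum f) => // r _ _.
  by rewrite -EFinM ltry.
apply: ge_ereal_sup => _ /= [A [finA _] <-].
apply: (@le_trans _ _ (\sum_(i \in A) ((a ^+ 2)%:E * (modulus (f i) ^+ 2)%:E))%E).
  apply: lee_fsum => // i _; rewrite -EFinM lee_fin -exprMn.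
  by rewrite ler_pXn2r ?nnegrE ?modulus_ge0 // (le_trans _ (gf i)) ?modulus_ge0.
rewrite -ge0_mule_fsumr //; apply: lee_wpmul2l.
  by rewrite lee_fin sqr_ge0.
by apply: esum_ge; exists A.
Qed.

Lemma square_summable_submod : submod_closed square_summable.
Proof.
have ge0 (h : I -> R[i]) i : (0 <= (modulus (h i) ^+ 2)%:E)%E.
  by rewrite lee_fin exprn_ge0 ?modulus_ge0.
split=> [|c f g fS gS].
  rewrite inE /sqsum esum1 // => i _.
  by rewrite [X in modulus X]/(GRing.zero _) /= modulus0 expr0n.
have dS (d : R[i]) (h : I -> R[i]) : h \in square_summable ->
    (fun i => d * h i) \in square_summable.
  by apply: (@square_summable_le (modulus d)) => i; rewrite modulusM.
have := dS 2 _ gS; have := dS (2 * c) _ fS.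
rewrite !inE => fS' gS'.
apply: le_lt_trans (lte_add_pinfty fS' gS').
have <- : (\esum_(i in [set: I]) ((modulus (2 * c * f i)%R ^+ 2)%:E +
    (modulus (2 * g i)%R ^+ 2)%:E))%E =
    (sqsum (fun i => 2 * c * f i)%R + sqsum (fun i => 2 * g i)%R)%E.
  by apply: esumD => i _; rewrite lee_fin exprn_ge0 ?modulus_ge0.
apply: le_esum => i _.
rewrite -EFinD lee_fin !fctE.
have -> : modulus (2 * c * f i) = 2 * modulus (c * f i).
  by rewrite -mulrA modulusM /modulus normr_nat.
have -> : modulus (2 * g i) = 2 * modulus (g i).
  by rewrite modulusM /modulus normr_nat.
have le2 (p q m : R) : 0 <= m -> m <= p + q ->
    m ^+ 2 <= (2 * p) ^+ 2 + (2 * q) ^+ 2.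
  move=> m0 mpq; apply: (@le_trans _ _ ((p + q) ^+ 2)).
    by rewrite ler_pXn2r ?nnegrE // (le_trans m0).
  rewrite -subr_ge0 (_ : _ - _ = (p - q) ^+ 2 + 2 * p ^+ 2 + 2 * q ^+ 2).
    by rewrite !addr_ge0 ?sqr_ge0 // pmulr_rge0 ?sqr_ge0.
  by ring.
by apply: le2; [exact: modulus_ge0 | exact: ler_modulusD].
Qed.

HB.instance Definition _ :=
  GRing.isSubmodClosed.Build R[i] (I -> R[i]) square_summable
    square_summable_submod.

End SquareSummable.

Definition ell2 (R : realType) (I : choiceType) : Type :=
  {f : I -> R[i] | f \in @square_summable R I}.
HB.instance Definition _ R I := SubChoice.on (ell2 R I).
HB.instance Definition _ (R : realType) (I : choiceType) :=
  [SubChoice_isSubLmodule of ell2 R I by <:].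

Section HilbertSpace.
Context {R : realType} {I : choiceType}.
Local Notation H := (ell2 R I).
Implicit Types (xi eta : H) (T S : H -> H).

Definition ell2_norm xi : R := Num.sqrt (fine (sqsum (val xi))).

Definition dotp xi eta : R[i] :=
  summability.sum (fun i => val xi i * (val eta i)^* : R[i]^o).

Lemma delta_subproof (i : I) :
  (fun j => (j == i)%:R) \in @square_summable R I.
Proof.
rewrite inE /sqsum.
have -> : (\esum_(j in [set: I]) (modulus (j == i)%:R ^+ 2)%:E)%E =
    (\esum_(j in [set: I]) if j \in [set i] then 1%:E else 0 : \bar R)%E.
  apply: eq_esum => j _; case: eqP => [->|ji].
    by rewrite mem_set //= /modulus normr1 expr1n.
  by rewrite memNset // modulus0 expr0n.
by rewrite -esum_mkcond esum_set1 ?ltry// lee_fin.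
Qed.

Definition delta (i : I) : H := exist (fun f => f \in square_summable) _ (delta_subproof i).

Lemma dotp_delta xi i : dotp xi (delta i) = val xi i.
Proof.
apply: (@cvg_lim R[i]^o); first exact: norm_hausdorff.
  exact: totally_filter.
apply: (@cvg_near_cst _ R[i]^o _ _ _ (@filter_filter _ _ totally_filter)).
exists [fset i]%fset => // A /= /fsubsetP iA.
have {}iA : i \in A by apply: iA; rewrite inE.
rewrite /partial_sum (bigD1 [` iA]%fset) //= eqxx conjC1 mulr1.
rewrite big1 ?addr0 // => j ji.
by rewrite -[_ == i]/(val j == val [` iA]%fset) val_eqE (negbTE ji) conjC0 mulr0.
Qed.

Definition op_norm_le T (c : R) : Prop :=
  forall xi, ell2_norm (T xi) <= c * ell2_norm xi.

Definition bounded_operator T : Prop :=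
  linear T /\ exists c : R, op_norm_le T c.

Definition is_adjoint T S : Prop :=
  forall xi eta, dotp (T xi) eta = dotp xi (S eta).

End HilbertSpace.

Definition sup_norm (R : realType) (Y : Type) (f : Y -> R[i]) : \bar R :=
  ereal_sup [set (modulus (f y))%:E | y in [set: Y]].

(* A is a concrete C*-algebra of bounded operators on l^2(I), E maps A to a
   commutative C*-algebra of functions on Y with the supremum norm, and ws is
   the adjoint w^*. *)
Definition norm_averaging (R : realType) (I : choiceType) (Y : Type)
    (A : set (ell2 R I -> ell2 R I))
    (E : (ell2 R I -> ell2 R I) -> Y -> R[i])
    (tau : (ell2 R I -> ell2 R I) -> R[i]) : Prop :=
  forall (F : set (ell2 R I -> ell2 R I)) (eps : R),
    finite_set F -> F `<=` A -> 0 < eps ->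
  exists w ws : ell2 R I -> ell2 R I,
    [/\ A w /\ A ws, is_adjoint w ws, ws \o w = id, w \o ws = id &
      forall x, F x ->
        (sup_norm (fun y => E (ws \o x \o w) y - tau x)%R < eps%:E)%E].

Definition borel_cantor := g_sigma_algebraType (@open cantor_space).

Section Actions.
Context {G : groupType}.
Local Notation X := cantor_space.
Implicit Types (act : G -> X -> X) (U V : set X).

Definition is_action act : Prop :=
  [/\ forall x, act 1%g x = x,
      forall g h x, act (g * h)%g x = act g (act h x) &
      forall g, continuous (act g)].

Definition minimal_action act : Prop :=
  forall Y : set X, closed Y -> (forall g, act g @` Y `<=` Y) ->
    Y = set0 \/ Y = setT.

Definition invariant_measure (R : realType) act
    (mu : probability borel_cantor R) : Prop :=
  forall (g : G) (B : set borel_cantor), measurable B ->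
    mu (act g @^-1` B) = mu B.

Definition uniquely_ergodic (R : realType) act : Prop :=
  exists mu : probability borel_cantor R, invariant_measure act mu /\
    forall nu : probability borel_cantor R, invariant_measure act nu ->
      forall B : set borel_cantor, measurable B -> nu B = mu B.

Definition strictly_ergodic (R : realType) act : Prop :=
  minimal_action act /\ uniquely_ergodic R act.

(* U \prec_G V; the pieces P j partition U. *)
Definition subequivalent act U V : Prop :=
  exists (n : nat) (P : 'I_n -> set X) (g : 'I_n -> G),
    [/\ forall j, clopen (P j), trivIset setT P, \bigcup_j P j = U,
        trivIset setT (fun j => act (g j) @` P j) &
        forall j, act (g j) @` P j `<=` V].

Definition dynamical_comparison (R : realType) act : Prop :=
  forall U V, clopen U -> clopen V ->
    (forall mu : probability borel_cantor R, invariant_measure act mu ->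
      (mu U < mu V)%E) ->
  subequivalent act U V.

End Actions.

Section CrossedProduct.
Context {R : realType} {G : groupType}.
Local Notation X := cantor_space.
Local Notation CX := (continuousType cantor_space R[i]^o).
Variable act : G -> X -> X.

(* C(X) acts on l^2(X) by multiplication, a faithful representation; the
   regular representation of the crossed product that it induces acts on
   l^2(G x X) = l^2(G, l^2(X)) by
     (f xi)(h) = alpha_(h^-1)(f) xi(h),   (u_g xi)(h) = xi(g^-1 h)
   where alpha_(h^-1)(f)(x) = f(h x). *)
Local Notation H := (ell2 R (G * X)%type).

Lemma multiplier_subproof (f : CX) (xi : H) :
  (fun k : G * X => f (act k.1 k.2) * val xi k) \in @square_summable R (G * X)%type.
Proof.
have [M fM] : exists M, forall x, modulus (f x) <= M.
  have cf : continuous (fun x => modulus (f x) : R^o).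
    move=> x; apply/cvgrPdist_lt => e e0.
    have e0C : 0 < e%:C by rewrite ltcR.
    have := @cts_fun _ _ f x; move=> /cvgrPdist_lt /(_ _ e0C).
    apply: filterS => y; rewrite -modulusE ltcR; apply: le_lt_trans.
    rewrite ler_distlC; have := ler_modulusD (f x - f y) (f y).
    have := ler_modulusD (f y - f x) (f x).
    have -> : modulus (f y - f x) = modulus (f x - f y).
      by rewrite /modulus distrC.
    by rewrite !subrK; lra.
  have /compact_bounded /pinfty_ex_gt0 [M _ fM] :=
    continuous_compact (continuous_subspaceT cf) cantor_space_compact.
  exists M => x; apply: le_trans (ler_norm _) _; apply: fM.
  by exists x.
move: (valP xi); apply: (@square_summable_le _ _ M) => k.
by rewrite modulusM ler_wpM2r ?modulus_ge0.
Qed.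

Definition multiplier (f : CX) (xi : H) : H := exist (fun f => f \in square_summable) _ (multiplier_subproof f xi).

Lemma translation_subproof (g : G) (xi : H) :
  (fun k : G * X => val xi ((g^-1 * k.1)%g, k.2)) \in @square_summable R (G * X)%type.
Proof.
rewrite inE /sqsum; move: (valP xi); rewrite inE /sqsum.
rewrite (reindex_esum setT setT (fun k : G * X => ((g^-1 * k.1)%g, k.2))) //.
split=> // [[h x] [k y] _ _ /= [/mulgI -> ->] //|[h x] _].
by exists ((g * h)%g, x); rewrite //= mulKg.
Qed.


Definition translation (g : G) (xi : H) : H := exist (fun f => f \in square_summable) _ (translation_subproof g xi).

Definition finite_crossed_sum (s : seq (CX * G)) (xi : H) : H :=
  \sum_(p <- s) multiplier p.1 (translation p.2 xi).

Definition reduced_crossed_product : set (H -> H) :=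
  [set T | bounded_operator T /\
    forall eps : R, 0 < eps -> exists s : seq (CX * G),
      op_norm_le (fun xi => T xi - finite_crossed_sum s xi) eps].

(* The compression of T to the subspace l^2({1} x X) is multiplication by this
   function; on finite sums it is the coefficient of the unit of G. *)
Definition cond_exp (T : H -> H) (x : X) : R[i] :=
  dotp (T (delta (1%g, x))) (delta (1%g, x)).

Lemma cond_exp_finite_sum (s : seq (CX * G)) (x : X) :
  (forall y, act 1%g y = y) ->
  cond_exp (finite_crossed_sum s) x = \sum_(p <- s | p.2 == 1%g) p.1 x.
Proof.
move=> act1; rewrite /cond_exp dotp_delta /finite_crossed_sum.
elim: s => [|p s IH]; first by rewrite !big_nil.
rewrite !big_cons.
have -> : forall u v : H, val (u + v) (1%g, x) = val u (1%g, x) + val v (1%g, x).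
  by [].
rewrite IH /= mulg1 act1 -pair_eqE /= eqxx andbT invg_eq1.
by case: eqP => _; rewrite ?mulr1 ?mulr0 ?add0r.
Qed.

End CrossedProduct.

Definition integral_state (R : realType) (mu : probability borel_cantor R)
    (f : cantor_space -> R[i]) : R[i] :=
  (\int[mu]_x complex.Re (f x))%R +i* (\int[mu]_x complex.Im (f x))%R.

(* Main.v *)
(* The levels of a tower over a clopen set A are disjoint piecewise translates of
   A by group elements. Comparison fills every member of a fine clopen
   partition of X by copies of A, and the remainder, of measure at most mu(A),
   is attached to A by comparison as well. When A is small, X is thereby cut
   into towers along each of which every member of the partition occurs with
   frequency close to its measure. Let w act on each tower with n levels by the
   unitary matrix M_il = theta_i n^(-1/2) omega^(il), omega a primitive n-th
   root of unity and theta_i = 1 or -1. As |M_il|^2 = 1/n, E(w^* f w) is the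
   average of f along the tower, hence close to mu(f). For g <> 1,
   E(w^* f u_g w) is on each level a normalised quadratic form in theta whose
   matrix has zero diagonal and at most one nonzero entry in each row and
   column, even when g has fixed points; there are O(n) such forms, and some
   choice of signs makes all of them o(1). *)
Require Import Defs.
From HB Require Import structures.
From mathcomp Require Import all_boot all_order all_algebra.
From mathcomp Require Import complex finmap.
From mathcomp Require Import all_classical all_reals all_analysis.
From mathcomp Require Import summability.
From mathcomp Require Import cyclic separable cyclotomic.
From mathcomp Require Import ring lra zify.

Set Implicit Arguments.
Unset Strict Implicit.
Unset Printing Implicit Defensive.
Import Order.TTheory GRing.Theory Num.Theory.
Import numFieldNormedType.Exports.

Local Open Scope classical_set_scope.
Local Open Scope complex_scope.
Local Open Scope ring_scope.

(** Fourth powers are needed to find the signs. A random choice makes a single form Q of order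
    n^(1/2), but a second-moment bound summed over O(n) forms gives only Q^2 = O(n^2) for the
    largest of them. Each fourth moment is O(n^2), so the sum is O(n^3) and every |Q| is O(n^(3/4)),
    which is o(n). The sparsity of the forms comes from labelling levels by group elements: f u_g
    couples the level j only with the level g^-1 j, a condition in G and not in X. For w to lie in
    the crossed product, its coefficients must be continuous. The signs may therefore depend on a
    base point only through locally constant data, namely the labels of its tower and the partition
    classes met along it; this is why f is replaced by a step function before the signs are chosen.
    By compactness only finitely many label lists occur, so w is a finite sum of terms c_t u_(t^-1),
    and it is bounded because it is isometric. Comparison demands a strict inequality, so a
    remainder of measure exactly mu(A) is cut in two before it is attached. *)

Section ModulusTheory.
Context {R : realType}.
Implicit Types z : R[i].

Lemma modulusN z : modulus (- z) = modulus z.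
Proof. by rewrite /modulus normrN. Qed.

Lemma modulusB z1 z2 : modulus (z1 - z2) = modulus (z2 - z1).
Proof. by rewrite -modulusN opprB. Qed.

Lemma modulus_real (x : R) : modulus x%:C = `|x|.
Proof. by rewrite /modulus normc_def /= expr0n addr0 sqrtr_sqr. Qed.

Lemma modulus_conj z : modulus z^* = modulus z.
Proof. by case: z => a b; rewrite /modulus !normc_def /= sqrrN. Qed.

Lemma modulus_sqr z : (modulus z ^+ 2)%:C = z * z^*.
Proof. by rewrite rmorphXn /= modulusE sqr_normc. Qed.

Lemma normr_Re_le z : `|complex.Re z| <= modulus z.
Proof.
case: z => a b; rewrite /modulus normc_def /= -sqrtr_sqr ler_wsqrtr //.
by rewrite lerDl sqr_ge0.
Qed.

Lemma normr_Im_le z : `|complex.Im z| <= modulus z.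
Proof.
case: z => a b; rewrite /modulus normc_def /= -sqrtr_sqr ler_wsqrtr //.
by rewrite lerDr sqr_ge0.
Qed.

Lemma modulus_le_ReIm z : modulus z <= `|complex.Re z| + `|complex.Im z|.
Proof.
rewrite {1}[z]complexE; apply: le_trans (ler_modulusD _ _) _.
rewrite modulusM !modulus_real -[_ * `|_|]mul1r mulrA lerD2l.
have -> : modulus ('i%C : R[i]) = 1.
  by rewrite /modulus normc_def /= expr0n expr1n add0r sqrtr1.
by rewrite !mul1r.
Qed.

Lemma modulus_sum (J : Type) (r : seq J) (P : pred J) (F : J -> R[i]) :
  modulus (\sum_(j <- r | P j) F j) <= \sum_(j <- r | P j) modulus (F j).
Proof.
elim/big_ind2: _ => //; first by rewrite modulus0.
by move=> a b c d ab cd; apply: le_trans (ler_modulusD _ _) (lerD _ _).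
Qed.

End ModulusTheory.

(** * Unconditional summation of complex families *)

Section UnconditionalSums.
Context {R : realType} {I : choiceType}.
Implicit Types (u v : I -> R[i]) (a : I -> R) (z l : R[i]).

(** [summability.sum] is a limit and says nothing unless that limit exists. This predicate carries
    existence and value together, in terms of the real modulus. *)
Definition has_sum u l := forall e : R, 0 < e ->
  exists A : {fset I}, forall B : {fset I}, (A `<=` B)%fset ->
    modulus (\sum_(i <- B) u i - l) < e.

Lemma has_sum_sum u l : has_sum u l -> summability.sum (u : I -> R[i]^o) = l.
Proof.
move=> ul; apply: (@cvg_lim R[i]^o); first exact: norm_hausdorff.
  exact: totally_filter.
apply/(@cvgrPdist_lt _ R[i]^o _ _ (@filter_filter _ _ totally_filter)) => e e0.
have eR : e = (complex.Re e)%:C by rewrite RRe_real // gtr0_real.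
have e0' : 0 < complex.Re e by rewrite -ltcR -eR.
have [A uA] := ul _ e0'; exists A => // B /= AB.
have {uA} := uA _ AB; rewrite -ltcR -eR modulusE distrC.
by rewrite /partial_sum (big_seq_fsetE _ _ xpredT u).
Qed.

Lemma has_sumD u v l l' : has_sum u l -> has_sum v l' ->
  has_sum (fun i => u i + v i) (l + l').
Proof.
move=> ul vl e e0; have e20 : 0 < e / 2 by rewrite divr_gt0.
have [A uA] := ul _ e20; have [A' vA] := vl _ e20.
exists (A `|` A')%fset => B; rewrite fsubUset => /andP[AB AB'].
rewrite big_split /= opprD addrACA [ltRHS](splitr e).
by apply: le_lt_trans (ler_modulusD _ _) (ltrD (uA _ _) (vA _ _)).
Qed.

Lemma has_sumZ z u l : has_sum u l -> has_sum (fun i => z * u i) (z * l).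
Proof.
move=> ul e e0.
have z0 : 0 < modulus z + 1 by rewrite ltr_wpDl ?modulus_ge0.
have [|A uA] := ul (e / (modulus z + 1)); first by rewrite divr_gt0.
exists A => B /uA; rewrite ltr_pdivlMr // => /(le_lt_trans _); apply.
rewrite -mulr_sumr -mulrBr modulusM mulrC ler_wpM2l ?modulus_ge0 //.
by rewrite lerDl.
Qed.

Lemma has_sum_reindex (f g : I -> I) u l : cancel f g -> cancel g f ->
  has_sum u l -> has_sum (u \o f) l.
Proof.
move=> fK gK ul e e0; have [A uA] := ul _ e0.
exists [fset g x | x in A]%fset => B AB.
have -> : \sum_(i <- B) (u \o f) i = \sum_(i <- [fset f x | x in B]%fset) u i.
  rewrite big_imfset //=.
  by move=> x y _ _; exact: (can_inj fK).
apply: uA; apply/fsubsetP => x xA; apply/imfsetP; exists (g x); rewrite ?gK //=.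
by apply: (fsubsetP AB); apply/imfsetP; exists x.
Qed.

Lemma has_sum_ge0 a (s : R) : (forall i, 0 <= a i) ->
  (\esum_(i in [set: I]) (a i)%:E)%E = s%:E -> has_sum (fun i => (a i)%:C) s%:C.
Proof.
move=> a0 as_ e e0.
have : (s%:E - e%:E < \esum_(i in [set: I]) (a i)%:E)%E.
  by rewrite as_ -EFinB lte_fin ltrBlDr ltrDl.
move=> /ereal_sup_gt[_ [D [finD _] <-]]; rewrite fsbig_finite // sumEFin lte_fin.
move=> sD; exists (fset_set D) => B DB.
have sB : \sum_(i <- B) a i <= s.
  have : (\sum_(i \in [set` B]) (a i)%:E <= \esum_(i in [set: I]) (a i)%:E)%E.
    by apply: esum_ge; exists [set` B].
  by rewrite fsbig_finite // set_fsetK sumEFin as_ lee_fin.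
have sDB : \sum_(i <- fset_set D) a i <= \sum_(i <- B) a i.
  rewrite (big_fsetID _ (mem (fset_set D)) B) /= ler_wpDr ?sumr_ge0 //.
  rewrite le_eqVlt; apply/orP; left; apply/eqP; apply: congr_big => //; congr enum_fset.
  by apply/fsetP => i; rewrite !inE /= andb_idl //; exact: (fsubsetP DB).
rewrite -rmorph_sum -rmorphB /= modulus_real ler0_norm; last by rewrite subr_le0.
by lra.
Qed.

(** Real and imaginary parts are summed separately. A real family b with |b| <= a is the difference
    of b + a and a, both nonnegative and dominated by 2 a. *)
Lemma ex_has_sum u (a : I -> R) : (forall i, modulus (u i) <= a i) ->
  (\esum_(i in [set: I]) (a i)%:E < +oo)%E -> exists l, has_sum u l.
Proof.
move=> ua asum.
have a0 i : 0 <= a i by apply: le_trans (ua i); exact: modulus_ge0.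
have ex_ge0 (b : I -> R) : (forall i, 0 <= b i) -> (forall i, b i <= a i + a i) ->
    exists l, has_sum (fun i => (b i)%:C) l.
  move=> b0 ba; have : (\esum_(i in [set: I]) (b i)%:E < +oo)%E.
    apply: le_lt_trans (lte_add_pinfty asum asum).
    rewrite -esumD => [|i _|i _]; rewrite ?lee_fin //.
    by apply: le_esum => i _; rewrite -EFinD lee_fin.
  have : (0 <= \esum_(i in [set: I]) (b i)%:E)%E.
    by apply: esum_ge0 => i _; rewrite lee_fin.
  case E : esum => [s| |] // _ _.
  by exists s%:C; apply: has_sum_ge0.
have part (f : R[i] -> R) : (forall z, `|f z| <= modulus z) ->
    exists l, has_sum (fun i => (f (u i))%:C) l.
  move=> fle; have fa i : `|f (u i)| <= a i by apply: le_trans (ua i).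
  have [||l fl] := ex_ge0 (fun i => f (u i) + a i).
  - by move=> i; have := fa i; rewrite ler_norml; lra.
  - by move=> i; have := fa i; rewrite ler_norml; lra.
  have [||l' al] := ex_ge0 a => // [i|]; first by rewrite lerDl.
  exists (l + (-1) * l'); move: (has_sumD fl (has_sumZ (-1) al)).
  by under eq_fun do rewrite mulN1r -rmorphB /= addrK.
have [l ul] := part _ (@normr_Re_le R).
have [l' ul'] := part _ (@normr_Im_le R).
exists (l + 'i%C * l'); move: (has_sumD ul (has_sumZ 'i%C ul')).
by under eq_fun do rewrite -complexE.
Qed.

End UnconditionalSums.

(** * Inner product, norm and adjoints on l^2(I) *)

Section InnerProduct.
Context {R : realType} {I : choiceType}.
Local Notation H := (ell2 R I).
Implicit Types (xi eta zeta : H) (T S : H -> H).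

Lemma sqsum_ge0 (f : I -> R[i]) : (0 <= sqsum f)%E.
Proof. by apply: esum_ge0 => i _; rewrite lee_fin sqr_ge0. Qed.

Lemma sqsum_val xi : sqsum (val xi) = (ell2_norm xi ^+ 2)%:E.
Proof.
have := sqsum_ge0 (val xi); have := valP xi; rewrite inE /ell2_norm.
case: (sqsum _) => // r _; rewrite lee_fin => r0.
by rewrite sqr_sqrtr.
Qed.

Lemma ell2_norm_ge0 xi : 0 <= ell2_norm xi.
Proof. exact: sqrtr_ge0. Qed.

Lemma modulus_le_norm xi i : modulus (val xi i) <= ell2_norm xi.
Proof.
rewrite -(@ler_pXn2r _ 2) ?nnegrE ?modulus_ge0 ?ell2_norm_ge0 //.
rewrite -lee_fin -sqsum_val; apply: esum_ge; exists [set i]; first by split.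
by rewrite fsbig_set1.
Qed.

Lemma ell2_norm_delta (i : I) : ell2_norm (delta i : H) = 1.
Proof.
rewrite /ell2_norm /sqsum.
have -> : (\esum_(j in [set: I]) (modulus (val (delta i : H) j) ^+ 2)%:E)%E =
    (\esum_(j in [set: I]) if j \in [set i] then 1%:E else 0 : \bar R)%E.
  apply: eq_esum => j _ /=; case: eqP => [->|ji].
    by rewrite mem_set //= /modulus normr1 expr1n.
  by rewrite memNset // modulus0 expr0n.
by rewrite -esum_mkcond esum_set1 ?lee_fin //= sqrtr1.
Qed.

Lemma dotp_has_sum xi eta :
  has_sum (fun i => val xi i * (val eta i)^*) (dotp xi eta).
Proof.
suff [l hl] : exists l, has_sum (fun i => val xi i * (val eta i)^*) l.
  by rewrite /dotp (has_sum_sum hl).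
apply: (@ex_has_sum _ _ _ (fun i => modulus (val xi i) ^+ 2 + modulus (val eta i) ^+ 2)).
  move=> i; rewrite modulusM modulus_conj.
  have := modulus_ge0 (val xi i); have := modulus_ge0 (val eta i).
  by nra.
under eq_esum do rewrite EFinD.
rewrite esumD => [|i _|i _]; rewrite ?lee_fin ?sqr_ge0 //.
by apply: lte_add_pinfty; [have := valP xi|have := valP eta]; rewrite inE.
Qed.

Lemma dotp_unique xi eta l :
  has_sum (fun i => val xi i * (val eta i)^*) l -> dotp xi eta = l.
Proof. exact: has_sum_sum. Qed.

Lemma dotpDl xi eta zeta : dotp (xi + eta) zeta = dotp xi zeta + dotp eta zeta.
Proof.
apply: dotp_unique; have := has_sumD (dotp_has_sum xi zeta) (dotp_has_sum eta zeta).
by under eq_fun do rewrite -mulrDl.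
Qed.

Lemma dotpDr xi eta zeta : dotp xi (eta + zeta) = dotp xi eta + dotp xi zeta.
Proof.
apply: dotp_unique; have := has_sumD (dotp_has_sum xi eta) (dotp_has_sum xi zeta).
by under eq_fun do rewrite -mulrDr -rmorphD.
Qed.

Lemma dotpxx xi : dotp xi xi = (ell2_norm xi ^+ 2)%:C.
Proof.
apply: dotp_unique; under eq_fun do rewrite -modulus_sqr.
by apply: has_sum_ge0 => [i|]; [exact: sqr_ge0 | rewrite -sqsum_val].
Qed.

Lemma dotp0l eta : dotp 0 eta = 0.
Proof. by have := dotpDl 0 0 eta; rewrite addr0 => /eqP; rewrite -subr_eq subrr => /eqP. Qed.

Lemma dotp0r eta : dotp eta 0 = 0.
Proof. by have := dotpDr eta 0 0; rewrite addr0 => /eqP; rewrite -subr_eq subrr => /eqP. Qed.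

Lemma is_adjoint_sum (J : Type) (s : seq J) (T S : J -> H -> H) :
  (forall j, is_adjoint (T j) (S j)) ->
  is_adjoint (fun xi => \sum_(j <- s) T j xi) (fun xi => \sum_(j <- s) S j xi).
Proof.
move=> TS xi eta; elim: s => [|j s IH]; first by rewrite !big_nil dotp0l dotp0r.
by rewrite !big_cons dotpDl dotpDr TS IH.
Qed.

Lemma adjoint_isometry T S xi : is_adjoint T S -> S \o T = id ->
  ell2_norm (T xi) = ell2_norm xi.
Proof.
move=> TS ST; have := dotpxx (T xi).
rewrite TS (_ : S (T xi) = xi) ?dotpxx; last by rewrite -[LHS]/((S \o T) xi) ST.
move=> /complexI /eqP; rewrite eqrXn2 ?ell2_norm_ge0 //.
by move=> /eqP.
Qed.

Lemma val_sum (J : Type) (s : seq J) (P : pred J) (F : J -> H) i :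
  val (\sum_(j <- s | P j) F j) i = \sum_(j <- s | P j) val (F j) i.
Proof. by apply: (big_morph (fun xi : H => val xi i)). Qed.

End InnerProduct.

(** * Finite sums in the crossed product and their adjoints *)

Section FiniteSums.
Context {R : realType} {G : groupType}.
Local Notation X := cantor_space.
Local Notation CX := (continuousType cantor_space R[i]^o).
Variable act : G -> X -> X.
Local Notation H := (ell2 R (G * X)%type).
Implicit Types (s : seq (CX * G)) (xi : H).

Lemma finite_crossed_sumE s xi (k : G * X) :
  val (finite_crossed_sum act s xi) k =
  \sum_(p <- s) p.1 (act k.1 k.2) * val xi ((p.2^-1 * k.1)%g, k.2).
Proof. by rewrite /finite_crossed_sum val_sum. Qed.

Lemma finite_crossed_sum_linear s : linear (finite_crossed_sum act s).
Proof.
move=> a xi eta; apply: val_inj; apply/funext => k.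
rewrite finite_crossed_sumE -[RHS]/(a * val (finite_crossed_sum act s xi) k +
  val (finite_crossed_sum act s eta) k) !finite_crossed_sumE.
rewrite mulr_sumr -big_split /=; apply: eq_bigr => p _.
transitivity (p.1 (act k.1 k.2) * (a * val xi ((p.2^-1 * k.1)%g, k.2) +
  val eta ((p.2^-1 * k.1)%g, k.2))) => //.
by rewrite mulrDr mulrCA.
Qed.

(** Boundedness is read off from the isometry, so the norms of the single terms need not be
    estimated. *)
Lemma isometric_finite_sum_crossed_product s :
  (forall xi, ell2_norm (finite_crossed_sum act s xi) = ell2_norm xi) ->
  reduced_crossed_product act (finite_crossed_sum act s).
Proof.
move=> iso; split; first split; first exact: finite_crossed_sum_linear.
  by exists 1 => xi; rewrite iso mul1r.
move=> eps eps0; exists s => xi; rewrite subrr.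
have -> : ell2_norm (0 : H) = 0.
  rewrite /ell2_norm /sqsum esum1 ?sqrtr0 // => k _.
  by rewrite -[val 0 k]/(0 : R[i]) modulus0 expr0n.
by rewrite mulr_ge0 ?ell2_norm_ge0 // ltW.
Qed.

Hypothesis act_action : is_action act.

Lemma act1 x : act 1%g x = x. Proof. by case: act_action. Qed.
Lemma actM g h x : act (g * h)%g x = act g (act h x). Proof. by case: act_action. Qed.
Lemma act_cont g : continuous (act g). Proof. by case: act_action. Qed.
Lemma actK g : cancel (act g) (act g^-1%g).
Proof. by move=> x; rewrite -actM mulVg act1. Qed.
Lemma actKV g : cancel (act g^-1%g) (act g).
Proof. by move=> x; rewrite -actM mulgV act1. Qed.

Lemma continuous_near_modulus (f : X -> R[i]) :
  continuous (f : X -> R[i]^o) <->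
  forall x (e : R), 0 < e -> \forall y \near x, modulus (f x - f y) < e.
Proof.
split=> [cf x e e0|fP x].
  have e0C : 0 < e%:C by rewrite ltcR.
  have := cf x; move=> /cvgrPdist_lt /(_ _ e0C).
  by apply: filterS => y; rewrite -modulusE ltcR.
apply/cvgrPdist_lt => e e0.
have eR : e = (complex.Re e)%:C by rewrite RRe_real // gtr0_real.
have e0' : 0 < complex.Re e by rewrite -ltcR -eR.
have := fP x _ e0'; apply: filterS => y.
by rewrite -ltcR -eR modulusE.
Qed.

Lemma adjoint_coef_continuous (f : CX) g :
  continuous ((fun x => (f (act g x))^*) : X -> R[i]^o).
Proof.
apply/continuous_near_modulus => x e e0.
have /continuous_near_modulus/(_ (act g x) _ e0) fN := @cts_fun _ _ f.
have : \forall y \near x, modulus (f (act g x) - f (act g y)) < e.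
  have := @act_cont g x _ fN.
  by [].

by apply: filterS => y /=; rewrite -rmorphB modulus_conj.
Qed.

Definition adjoint_term (p : CX * G) : CX * G :=
  (mkcts (@adjoint_coef_continuous p.1 p.2) : CX, p.2^-1%g).

Lemma adjoint_termP (p : CX * G) :
  is_adjoint (fun xi => multiplier act p.1 (translation p.2 xi))
    (fun xi => multiplier act (adjoint_term p).1 (translation (adjoint_term p).2 xi)).
Proof.
case: p => f g xi eta; symmetry; apply: dotp_unique => /=.
have cK : cancel (fun k : G * X => ((g * k.1)%g, k.2))
    (fun k : G * X => ((g^-1 * k.1)%g, k.2)) by case=> h x; rewrite /= mulKg.
have cK' : cancel (fun k : G * X => ((g^-1 * k.1)%g, k.2))
    (fun k : G * X => ((g * k.1)%g, k.2)) by case=> h x; rewrite /= mulVKg.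
have := dotp_has_sum (multiplier act f (translation g xi)) eta.
move=> /(has_sum_reindex cK cK').
congr has_sum; apply/funext => -[h x].
rewrite -[RHS]/(val xi (h, x) *
  ((f (act g (act h x)))^* * val eta ((g^-1^-1 * h)%g, x))^*) /=.
by rewrite mulKg invgK rmorphM /= conjCK actM // mulrA [_ * f _]mulrC.
Qed.

Lemma finite_crossed_sum_adjoint s :
  is_adjoint (finite_crossed_sum act s)
    (finite_crossed_sum act (map adjoint_term s)).
Proof.
have := is_adjoint_sum s adjoint_termP.
congr is_adjoint; apply/funext => xi.
by rewrite /finite_crossed_sum big_map.
Qed.

End FiniteSums.

(** * Integration of continuous complex functions on the Cantor set *)

Section ContinuousIntegrals.
Context {R : realType}.
Local Notation X := cantor_space.
Variable mu : probability borel_cantor R.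
Implicit Types (f g : X -> R[i]).

Lemma clopen_measurable (U : set X) : clopen U -> measurable (U : set borel_cantor).
Proof. by move=> [Uo _]; exact: sub_sigma_algebra. Qed.

Lemma continuous_measurable (u : X -> R) : continuous (u : X -> R^o) ->
  measurable_fun [set: borel_cantor] (u : borel_cantor -> R).
Proof.
move=> cu; apply: (measurability _ (measurable_realfun.RGenOpens.measurableE R)).
move=> _ [_ [a [b ->]] <-]; rewrite setTI; apply: sub_sigma_algebra.
by move/continuousP : cu; apply; exact: interval_open.
Qed.

Lemma continuous_integrable (u : X -> R) : continuous (u : X -> R^o) ->
  mu.-integrable [set: borel_cantor] (EFin \o u).
Proof.
move=> cu; apply: measurable_bounded_integrable => //.
- by apply: (@le_lt_trans _ _ 1%E); [exact: (@probability_le1 _ _ _ mu) | exact: ltry].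
- exact: continuous_measurable.
have /compact_bounded := continuous_compact (continuous_subspaceT cu) cantor_space_compact.
move=> [M [Mr uM]]; exists M; split=> // N /uM {}uM x _.
by apply: uM; exists x.
Qed.

Lemma continuous_Re f : continuous (f : X -> R[i]^o) ->
  continuous ((fun x => complex.Re (f x)) : X -> R^o).
Proof.
move=> /continuous_near_modulus cf x; apply/cvgrPdist_lt => e e0.
have := cf x _ e0; apply: filterS => y; apply: le_lt_trans.
by rewrite -raddfB normr_Re_le.
Qed.

Lemma continuous_Im f : continuous (f : X -> R[i]^o) ->
  continuous ((fun x => complex.Im (f x)) : X -> R^o).
Proof.
move=> /continuous_near_modulus cf x; apply/cvgrPdist_lt => e e0.
have := cf x _ e0; apply: filterS => y; apply: le_lt_trans.
by rewrite -raddfB normr_Im_le.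
Qed.

Lemma integral_stateD f g : continuous (f : X -> R[i]^o) ->
    continuous (g : X -> R[i]^o) ->
  integral_state mu (fun x => f x + g x) = integral_state mu f + integral_state mu g.
Proof.
move=> cf cg; rewrite /integral_state.
under eq_Rintegral do rewrite raddfD /=.
rewrite RintegralD //; [|exact/continuous_integrable/continuous_Re..].
under [X in _ +i* X]eq_Rintegral do rewrite raddfD /=.
by rewrite RintegralD //; exact/continuous_integrable/continuous_Im.
Qed.

Lemma integral_state0 : integral_state mu (fun=> 0) = 0.
Proof. by rewrite /integral_state /= Rintegral_cst // !mul0r. Qed.

(** Real and imaginary parts are estimated separately, which costs the factor 2. *)
Lemma integral_state_le f g (e : R) : continuous (f : X -> R[i]^o) ->
    continuous (g : X -> R[i]^o) -> (forall x, modulus (f x - g x) <= e) ->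
  modulus (integral_state mu f - integral_state mu g) <= e + e.
Proof.
move=> cf cg fg.
have le_int (u v : X -> R) : continuous (u : X -> R^o) -> continuous (v : X -> R^o) ->
    (forall x, `|u x - v x| <= e) ->
    `|(\int[mu]_x u x)%R - (\int[mu]_x v x)%R| <= e.
  move=> cu cv uv.
  have cuv : continuous ((fun x => u x - v x) : X -> R^o).
    by move=> x; apply: cvgB; [exact: cu | exact: cv].
  rewrite -RintegralB //; [|exact/continuous_integrable..].
  apply: le_trans (le_normr_Rintegral _ _) _ => //.
    exact: (continuous_integrable cuv).
  have -> : e = (\int[mu]_x (fun=> e) x)%R.
    rewrite Rintegral_cst // (_ : fine _ = 1) ?mulr1 //.
    by have /(congr1 fine) := probability_setT mu.
  apply: le_Rintegral => //.
    by apply: continuous_integrable => x; apply: cvg_norm; exact: cuv.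
  by apply: continuous_integrable => x; exact: cvg_cst.
apply: le_trans (modulus_le_ReIm _) _; rewrite /integral_state !raddfB /=.
apply: lerD.
  apply: le_int => [||x]; [exact: continuous_Re|exact: continuous_Re|].
  by rewrite -raddfB (le_trans (normr_Re_le _)).
apply: le_int => [||x]; [exact: continuous_Im|exact: continuous_Im|].
by rewrite -raddfB (le_trans (normr_Im_le _)).
Qed.

Lemma continuous_indic (U : set X) : clopen U -> continuous (\1_U : X -> R^o).
Proof.
move=> [Uo Uc] x; have [xU|xU] := pselect (U x).
  apply: (@cvg_near_cst _ R^o).
  have : nbhs x U by exact: open_nbhs_nbhs.
  by apply: filterS => y yU; rewrite !indicE !mem_set.
apply: (@cvg_near_cst _ R^o).
have : nbhs x (~` U) by apply: open_nbhs_nbhs; split => //; exact: closed_openC.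
by apply: filterS => y yU; rewrite !indicE !memNset.
Qed.

Lemma integral_state_indic (U : set X) (z : R[i]) : clopen U ->
  integral_state mu (fun x => z * (\1_U x)%:C) = (fine (mu U))%:C * z.
Proof.
move=> cU; have iU := continuous_integrable (continuous_indic cU).
have ind_int : (\int[mu]_x (\1_U x : R))%R = fine (mu U).
  rewrite /Rintegral integral_indic //; last exact: clopen_measurable.
  by rewrite setIT.
case: z => a b; rewrite /integral_state.
under eq_Rintegral do rewrite /= mulr0 subr0.
under [X in _ +i* X]eq_Rintegral do rewrite /= mulr0 add0r.
rewrite !RintegralZl // ind_int; apply/eqP; rewrite eq_complex /=.
by rewrite !mul0r subr0 addr0 mulrC [b * _]mulrC !eqxx.
Qed.

End ContinuousIntegrals.

(** * Norm estimate and continuity for the conditional expectation *)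

Section CondExp.
Context {R : realType} {G : groupType}.
Local Notation X := cantor_space.
Local Notation CX := (continuousType cantor_space R[i]^o).
Variable act : G -> X -> X.
Local Notation H := (ell2 R (G * X)%type).
Implicit Types (T S : H -> H).

Lemma cond_expE T x : cond_exp T x = val (T (delta (1%g, x))) (1%g, x).
Proof. exact: dotp_delta. Qed.

Lemma cond_exp_le T S (c : R) x : op_norm_le (fun xi => T xi - S xi) c ->
  modulus (cond_exp T x - cond_exp S x) <= c.
Proof.
move=> TS; rewrite !cond_expE.
have := TS (delta (1%g, x)); rewrite ell2_norm_delta mulr1.
by apply: le_trans; exact: (modulus_le_norm (T _ - S _)).
Qed.

Lemma cond_exp_finite_sum_continuous (s : seq (CX * G)) :
  (forall y, act 1%g y = y) ->
  continuous (cond_exp (finite_crossed_sum act s) : X -> R[i]^o).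
Proof.
move=> a1; have -> : cond_exp (finite_crossed_sum act s) =
    (fun x => \sum_(p <- s | p.2 == 1%g) (p.1 : X -> R[i]) x).
  by apply/funext => x; exact: cond_exp_finite_sum.
elim: s => [|p s IH].
  rewrite (_ : (fun x => _) = cst (0 : R[i]^o)); last first.
    by apply/funext => x; rewrite big_nil.
  by move=> x; exact: cvg_cst.
rewrite (_ : (fun x => _) = (fun x => (if p.2 == 1%g then p.1 x else 0) +
    \sum_(q <- s | q.2 == 1%g) (q.1 : X -> R[i]) x) :> (X -> R[i]^o)); last first.
  by apply/funext => x; rewrite big_cons; case: ifP; rewrite ?add0r.
move=> x; apply: (@cvgD _ R[i]^o); last exact: IH.
by case: eqP => _; [exact: cts_fun | exact: cvg_cst].
Qed.

(** E(T) is the uniform limit of the functions E(S), S a finite sum. Continuity makes E(T)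
    integrable, so that tau(T) can be compared with tau(S). *)
Lemma cond_exp_continuous T : (forall y, act 1%g y = y) ->
  reduced_crossed_product act T -> continuous (cond_exp T : X -> R[i]^o).
Proof.
move=> a1 [_ TA]; apply/continuous_near_modulus => x e e0.
have e30 : 0 < e / 3 by rewrite divr_gt0.
have [s Ts] := TA _ e30.
have /continuous_near_modulus/(_ x _ e30) := @cond_exp_finite_sum_continuous s a1.
apply: filterS => y sxy.
have := cond_exp_le x Ts; have := cond_exp_le y Ts.
set Tx := cond_exp T x; set Ty := cond_exp T y.
rewrite modulusB; move: sxy; set sx := cond_exp _ x; set sy := cond_exp _ y => h1 h2 h3.
have -> : Tx - Ty = (Tx - sx) + ((sx - sy) + (sy - Ty)) by ring.
by apply: le_lt_trans (ler_modulusD _ _) _; have := ler_modulusD (sx - sy) (sy - Ty); lra.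
Qed.

End CondExp.

(* A castle is encoded by its base points: [tower x] lists the group elements
   carrying [x] to the levels above it, so that every point of [X] is
   [act h x] for exactly one pair with [h \in tower x]. *)
Record castle (G : groupType) (act : G -> cantor_space -> cantor_space)
    (tower : cantor_space -> seq G) : Prop := Castle {
  castle_uniq : forall x, uniq (tower x);
  castle_inj : forall x y h k, h \in tower x -> k \in tower y ->
    act h x = act k y -> x = y /\ h = k;
  castle_cover : forall y, exists x h, h \in tower x /\ act h x = y }.

(** * The unitary attached to a castle and a matrix on each tower *)

Section CastleUnitary.
Context {R : realType} {G : groupType}.
Local Notation X := cantor_space.
Local Notation CX := (continuousType cantor_space R[i]^o).
Local Notation H := (ell2 R (G * X)%type).
Variable act : G -> X -> X.
Hypothesis act_action : is_action act.
Variables (tower : X -> seq G) (base : X -> X) (level : X -> G).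
Hypothesis towerP : castle act tower.
Hypothesis levelP : forall y, level y \in tower (base y).
Hypothesis level_base : forall y, act (level y) (base y) = y.
Variable M : X -> G -> G -> R[i].
Hypothesis M_rows : forall x h k, h \in tower x -> k \in tower x ->
  \sum_(j <- tower x) M x h j * (M x k j)^* = (h == k)%:R.
Hypothesis M_cols : forall x h k, h \in tower x -> k \in tower x ->
  \sum_(j <- tower x) (M x j h)^* * M x j k = (h == k)%:R.
Variable steps : seq G.
Hypothesis steps_uniq : uniq steps.
Hypothesis stepsP : forall x h k, h \in tower x -> k \in tower x ->
  (k * h^-1)%g \in steps.
Variable c : G -> CX.
Hypothesis cE : forall t y, c t y =
  if (t * level y)%g \in tower (base y)
  then M (base y) (level y) (t * level y)%g else 0.

Lemma castle_unique x h y : h \in tower x -> act h x = y ->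
  base y = x /\ level y = h.
Proof.
by move=> hx hy; apply: (castle_inj towerP (levelP y) hx); rewrite level_base.
Qed.

(** At a point of level h the coefficient of u_(t^-1) is the entry (h, t h) of the matrix, since
    u_(t^-1) reads a vector off t levels further. The list [steps] contains every k h^-1 joining two
    levels of a tower. *)
Definition castle_terms : seq (CX * G) := [seq (c t, t^-1%g) | t <- steps].

Definition castle_unitary : H -> H := finite_crossed_sum act castle_terms.

Definition castle_unitary_adj : H -> H :=
  finite_crossed_sum act (map (adjoint_term act_action) castle_terms).

Lemma sum_steps_level x h (F : G -> R[i]) : h \in tower x ->
  \sum_(t <- steps) (if (t * h)%g \in tower x then F (t * h)%g else 0) =
  \sum_(k <- tower x) F k.
Proof.
move=> hx; rewrite -big_mkcond /= -[LHS]big_filter.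
rewrite -(big_map (fun t => t * h)%g xpredT F).
apply: perm_big; apply: uniq_perm.
- by rewrite map_inj_uniq ?filter_uniq //; exact: mulIg.
- exact: (castle_uniq towerP).
- move=> k; apply/mapP/idP => [[t]|kx].
    by rewrite mem_filter => /andP[tx _] ->.
  by exists (k * h^-1)%g; rewrite ?mem_filter ?mulgVK ?kx //; exact: stepsP hx kx.
Qed.

Lemma sum_steps_level_inv x h (F : G -> R[i]) : h \in tower x ->
  \sum_(t <- steps) (if (t^-1 * h)%g \in tower x then F (t^-1 * h)%g else 0) =
  \sum_(k <- tower x) F k.
Proof.
move=> hx; rewrite -big_mkcond /= -[LHS]big_filter.
rewrite -(big_map (fun t => t^-1 * h)%g xpredT F).
apply: perm_big; apply: uniq_perm.
- rewrite map_inj_uniq ?filter_uniq // => s t /mulIg; exact: invg_inj.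
- exact: (castle_uniq towerP).
- move=> k; apply/mapP/idP => [[t]|kx].
    by rewrite mem_filter => /andP[tx _] ->.
  exists (h * k^-1)%g; last by rewrite invgF mulgVK.
  by rewrite ?mem_filter invgF mulgVK kx; exact: stepsP kx hx.
Qed.

(** The index (k, x) lies over the point y = k x, and j (level y)^-1 carries y to level j of the
    same tower. On the indices obtained in this way w acts as the matrix M of the tower. *)
Lemma castle_unitaryE xi k x : let y := act k x in
  val (castle_unitary xi) (k, x) =
  \sum_(j <- tower (base y)) M (base y) (level y) j *
    val xi ((j * (level y)^-1 * k)%g, x).
Proof.
move=> y; rewrite finite_crossed_sumE big_map /=.
rewrite -(sum_steps_level (fun j => M _ _ j * _) (levelP y)).
apply: eq_bigr => t _; rewrite cE -/y invgK; case: ifP => // _; last by rewrite mul0r.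
by rewrite mulgK.
Qed.

Lemma castle_unitary_adjE xi k x : let y := act k x in
  val (castle_unitary_adj xi) (k, x) =
  \sum_(j <- tower (base y)) (M (base y) j (level y))^* *
    val xi ((j * (level y)^-1 * k)%g, x).
Proof.
move=> y; rewrite finite_crossed_sumE !big_map.
rewrite -(sum_steps_level_inv (fun j => (M _ j _)^* * _) (levelP y)).
apply: eq_bigr => t _.
rewrite -[LHS]/((c t (act t^-1 y))^* * val xi ((t^-1^-1^-1 * k)%g, x)) cE invgK.
set z := act t^-1%g y.
have [yx|yx] := boolP (t^-1 * level y \in tower (base y))%g.
  have [|-> ->] := castle_unique (y := z) yx.
    by rewrite actM // level_base.
  by rewrite mulVKg levelP mulgK.
rewrite (_ : _ \in _ = false) ?conjC0 ?mul0r //; apply/negP => zx.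
have [|yz lz] := castle_unique (y := y) zx.
  by rewrite actM // level_base actKV.
by move: yx; rewrite yz lz mulKg levelP.
Qed.

Lemma level_shift k x j (y := act k x) : j \in tower (base y) ->
  base (act (j * (level y)^-1 * k)%g x) = base y /\
  level (act (j * (level y)^-1 * k)%g x) = j.
Proof.
move=> jx; apply: castle_unique => //.
by rewrite !actM // -/y -{3}(level_base y) actK.
Qed.

Lemma castle_unitaryK : castle_unitary_adj \o castle_unitary = id.
Proof.
apply/funext => xi; apply: val_inj; apply/funext => -[k x] /=.
rewrite -[LHS]/(val (castle_unitary_adj (castle_unitary xi)) (k, x)).
rewrite castle_unitary_adjE; set y := act k x.
transitivity (\sum_(j <- tower (base y)) \sum_(i <- tower (base y))
    ((M (base y) j (level y))^* * M (base y) j i) *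
    val xi ((i * (level y)^-1 * k)%g, x)).
  apply: eq_big_seq => j jx; rewrite castle_unitaryE.
  have [-> ->] := level_shift jx.
  rewrite mulr_sumr; apply: eq_bigr => i _.
  by rewrite mulrA -!mulgA mulKg.
rewrite exchange_big /= (big_rem _ (levelP y)) /= -mulr_suml M_cols ?levelP //.
rewrite eqxx mul1r mulgV mul1g big_seq big1 ?addr0 // => i ix.
rewrite -mulr_suml M_cols ?levelP //; last exact: mem_rem ix.
move: ix; rewrite mem_rem_uniq ?(castle_uniq towerP) // !inE eq_sym.
by case/andP => /negbTE -> _; rewrite mul0r.
Qed.

Lemma castle_unitaryVK : castle_unitary \o castle_unitary_adj = id.
Proof.
apply/funext => xi; apply: val_inj; apply/funext => -[k x] /=.
rewrite -[LHS]/(val (castle_unitary (castle_unitary_adj xi)) (k, x)).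
rewrite castle_unitaryE; set y := act k x.
transitivity (\sum_(j <- tower (base y)) \sum_(i <- tower (base y))
    (M (base y) (level y) j * (M (base y) i j)^*) *
    val xi ((i * (level y)^-1 * k)%g, x)).
  apply: eq_big_seq => j jx; rewrite castle_unitary_adjE.
  have [-> ->] := level_shift jx.
  rewrite mulr_sumr; apply: eq_bigr => i _.
  by rewrite mulrA -!mulgA mulKg.
rewrite exchange_big /= (big_rem _ (levelP y)) /= -mulr_suml M_rows ?levelP //.
rewrite eqxx mul1r mulgV mul1g big_seq big1 ?addr0 // => i ix.
rewrite -mulr_suml M_rows ?levelP //; last exact: mem_rem ix.
move: ix; rewrite mem_rem_uniq ?(castle_uniq towerP) // !inE eq_sym.
by case/andP => /negbTE -> _; rewrite mul0r.
Qed.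

Lemma castle_unitary_adjoint : is_adjoint castle_unitary castle_unitary_adj.
Proof. exact: finite_crossed_sum_adjoint. Qed.

Lemma castle_unitary_iso xi : ell2_norm (castle_unitary xi) = ell2_norm xi.
Proof. exact: adjoint_isometry castle_unitary_adjoint castle_unitaryK. Qed.

Lemma castle_unitary_adj_iso xi : ell2_norm (castle_unitary_adj xi) = ell2_norm xi.
Proof.
rewrite -castle_unitary_iso.
by rewrite -[castle_unitary _]/((castle_unitary \o castle_unitary_adj) xi) castle_unitaryVK.
Qed.

Lemma castle_unitary_delta y k : val (castle_unitary (delta (1%g, y))) (k, y) =
  if (k * level y)%g \in tower (base y)
  then M (base y) (k * level y)%g (level y) else 0.
Proof.
rewrite castle_unitaryE /=; set z := act k y.
have sum_eq j : ((j * (level z)^-1 * k)%g, y) == (1%g, y) = (j == k^-1 * level z)%g.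
  by rewrite -pair_eqE /= eqxx andbT -mulgA mulg_eq1 invgM invgK.
under eq_bigr do rewrite sum_eq.
case: ifP => ky.
  have [|-> lz] := castle_unique (y := z) ky; first by rewrite actM // level_base.
  rewrite lz mulKg (big_rem _ (levelP y)) /= eqxx mulr1 big_seq big1 ?addr0 // => j.
  rewrite mem_rem_uniq ?(castle_uniq towerP) // !inE => /andP[/negbTE -> _].
  by rewrite mulr0.
rewrite big_seq big1 // => j jx; case: eqP => [jE|_]; last by rewrite mulr0.
have [|by_ ly] := castle_unique (y := y) jx.
  by rewrite jE actM // level_base actK.
by move: ky; rewrite by_ ly jE mulVKg levelP.
Qed.

(** The vector w delta_(1, y) lives on the levels of the tower through y, and u_g shifts labels by
    g^-1. A term survives only if g^-1 j is again a label of the tower; labels are compared in G, so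
    a fixed point of g creates no further term. *)
Lemma cond_exp_conj (f : CX) (g : G) y :
  cond_exp (castle_unitary_adj \o
    (fun xi => multiplier act f (translation g xi)) \o castle_unitary) y =
  \sum_(j <- tower (base y) | (g^-1 * j)%g \in tower (base y))
    (M (base y) j (level y))^* * f (act j (base y)) *
    M (base y) (g^-1 * j)%g (level y).
Proof.
rewrite cond_expE castle_unitary_adjE act1 //= [RHS]big_mkcond /=.
apply: eq_bigr => j _.
rewrite mulg1 castle_unitary_delta mulgA mulgVK.
have -> : act (j * (level y)^-1)%g y = act j (base y).
  by rewrite actM // -{2}(level_base y) actK.
by case: ifP => _; rewrite ?mulr0 // mulrA.
Qed.

End CastleUnitary.

(** * Signs that make many sparse quadratic forms small at once *)

Section Signs.
Context {R : realType}.

Definition quad_form (C : nat -> nat -> R) (theta : nat -> R) (m : nat) : R :=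
  \sum_(i < m) \sum_(j < m) C i j * theta i * theta j.

(** The zero diagonal makes the form affine in the last sign, so its two choices lead to Q + d and Q
    - d. *)
Lemma quad_formS C theta m : C m m = 0 ->
  quad_form C theta m.+1 = quad_form C theta m +
    theta m * (\sum_(j < m) (C m j + C j m) * theta j).
Proof.
move=> Cm; rewrite /quad_form big_ord_recr /= big_ord_recr /= Cm !mul0r addr0.
under eq_bigr do rewrite big_ord_recr /=.
rewrite big_split /= -addrA; congr (_ + _).
rewrite -big_split mulr_sumr; apply: eq_bigr => j _ /=; ring.
Qed.

Lemma eq_quad_form C theta theta' m : (forall i, (i < m)%N -> theta i = theta' i) ->
  quad_form C theta m = quad_form C theta' m.
Proof.
by move=> tt'; apply: eq_bigr => i _; apply: eq_bigr => j _; rewrite !tt'.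
Qed.

(* The signs are chosen one after the other: averaged over the next sign, the
   potential [Q^4 + 24 m Q^2 + 48 m^2], with [m] signs still to be chosen, does
   not increase. *)
Lemma ex_signs (K : eqType) (ks : seq K) (C : K -> nat -> nat -> R) (n : nat) :
    (forall k i, C k i i = 0) ->
    (forall k i, \sum_(j < n) `|C k i j| <= 1) ->
    (forall k j, \sum_(i < n) `|C k i j| <= 1) ->
  exists theta : nat -> R, (forall i, theta i = 1 \/ theta i = -1) /\
    forall k, k \in ks ->
      quad_form (C k) theta n ^+ 4 <= 48 * (size ks)%:R * n%:R ^+ 2.
Proof.
move=> C0 Crow Ccol.
pose pot (m : nat) (Q : R) := Q ^+ 4 + 24 * m%:R * Q ^+ 2 + 48 * m%:R ^+ 2.
suff /(_ n (leqnn n)) [theta [theta1 pott]] : forall m, (m <= n)%N ->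
    exists theta : nat -> R, (forall i, theta i = 1 \/ theta i = -1) /\
      \sum_(k <- ks) pot (n - m)%N (quad_form (C k) theta m) <=
      48 * (size ks)%:R * n%:R ^+ 2.
  exists theta; split => // k kks; apply: le_trans pott.
  rewrite (big_rem _ kks) /= subnn /pot mulr0 mul0r expr0n mulr0 !addr0 lerDl.
  apply: sumr_ge0 => j _.
  by rewrite mul0r !addr0 exprn_even_ge0.
elim=> [_|m IH mn].
  exists (fun=> 1); split; first by left.
  rewrite subn0; under eq_bigr do rewrite /quad_form big_ord0 /pot !expr0n /= mulr0 !add0r.
  by rewrite big_const_seq count_predT iter_addr_0 -[leLHS]mulr_natr mulrAC lexx.
have [theta [theta1 pott]] := IH (ltnW mn).
pose d k := \sum_(j < m) (C k m j + C k j m) * theta j.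
have thetaN i : `|theta i| = 1 by case: (theta1 i) => ->; rewrite ?normrN normr1.
(* The new row and the new column contribute at most 1 each to the increment. *)
have d2 k : d k ^+ 2 <= 4.
  suff : `|d k| <= 2.
    by rewrite -(@ler_pXn2r _ 2) ?nnegrE // real_normK ?num_real // => /le_trans; apply; rewrite -natrX.
  apply: le_trans (ler_norm_sum _ _ _) _.
  have le_sub (u : nat -> R) : (forall j, 0 <= u j) -> \sum_(j < m) u j <= \sum_(j < n) u j.
    move=> u0; rewrite -(big_mkord xpredT) -(big_mkord xpredT u).
    by rewrite (@big_cat_nat _ _ _ m 0 n) ?(ltnW mn) //= lerDl sumr_ge0.
  apply: (@le_trans _ _ (\sum_(j < m) `|C k m j| + \sum_(j < m) `|C k j m|)).
    rewrite -big_split; apply: ler_sum => j _ /=.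
    by rewrite normrM thetaN mulr1 ler_normD.
  have -> : 2 = 1 + 1 :> R by ring.
  apply: lerD; [apply: le_trans (Crow k m)|apply: le_trans (Ccol k m)].
    exact: (le_sub (fun j => `|C k m j|)).
  exact: (le_sub (fun j => `|C k j m|)).
pose Q k := quad_form (C k) theta m.
(* With r signs left, the mean of (Q + d)^4 and (Q - d)^4 is Q^4 + 6 d^2 Q^2 + d^4, and 6 d^2 <= 24
   is the decrease of the coefficient of Q^2. The remaining 24 r d^2 + d^4 <= 96 r + 16 is paid for
   by 48 (r + 1)^2 - 48 r^2 = 96 r + 48. *)
have avg k : pot (n - m.+1)%N (Q k + d k) + pot (n - m.+1)%N (Q k - d k) <=
    2 * pot (n - m)%N (Q k).
  rewrite (_ : (n - m)%N = (n - m.+1).+1)%N; last by rewrite subnSK.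
  rewrite /pot; move: (n - m.+1)%N => r; rewrite -[r.+1]addn1 natrD.
  have := d2 k; have := sqr_ge0 (d k); have := sqr_ge0 (Q k).
  have : 0 <= r%:R :> R by [].
  move: (r%:R) (Q k) (d k) => {}r q e r0 q0 e0 e4.
  have h1 : 0 <= (4 - e ^+ 2) * q ^+ 2 by rewrite mulr_ge0 // subr_ge0.
  have h2 : 0 <= (4 - e ^+ 2) * (4 + e ^+ 2) by apply: mulr_ge0; lra.
  have h3 : 0 <= r * (4 - e ^+ 2) by rewrite mulr_ge0 // subr_ge0.
  rewrite -subr_ge0.
  rewrite (_ : _ - _ = 12 * ((4 - e ^+ 2) * q ^+ 2) +
    2 * ((4 - e ^+ 2) * (4 + e ^+ 2)) + 48 * (r * (4 - e ^+ 2)) + 64); last ring.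
  by rewrite !addr_ge0 // mulr_ge0.
have [s [s1 pots]] : exists s : R, (s = 1 \/ s = -1) /\
    \sum_(k <- ks) pot (n - m.+1)%N (Q k + s * d k) <= 48 * (size ks)%:R * n%:R ^+ 2.
  have sumavg : \sum_(k <- ks) pot (n - m.+1)%N (Q k + d k) +
      \sum_(k <- ks) pot (n - m.+1)%N (Q k - d k) <=
      2 * (48 * (size ks)%:R * n%:R ^+ 2).
    rewrite -big_split /=; apply: le_trans (ler_sum _ (fun k _ => avg k)) _.
    by rewrite -mulr_sumr ler_wpM2l.
  have [le1|lt1] := leP (\sum_(k <- ks) pot (n - m.+1)%N (Q k + d k))
    (48 * (size ks)%:R * n%:R ^+ 2).
    by exists 1; split; [left|under eq_bigr do rewrite mul1r].
  exists (-1); split; first by right.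
  by under eq_bigr do rewrite mulN1r; move: sumavg lt1; lra.
pose theta' i := if i == m then s else theta i.
exists theta'; split => [i|]; first by rewrite /theta'; case: eqP.
apply: le_trans pots; apply: ler_sum => k _.
have tt' i : (i < m)%N -> theta' i = theta i by rewrite /theta' => /ltn_eqF ->.
rewrite quad_formS // (eq_quad_form _ tt') {1}/theta' eqxx.
by rewrite /d; under [X in s * X]eq_bigr => j _ do rewrite tt' //.
Qed.

(** Real and imaginary parts count as separate real forms. This doubles their number, whence 96 = 2
    * 48, and adding the two bounds e n gives 2 e n. *)
Lemma ex_signs_complex (K : eqType) (ks : seq K) (C : K -> nat -> nat -> R[i])
    (n : nat) (e : R) : 0 <= e ->
    (forall k i, C k i i = 0) ->
    (forall k i, \sum_(j < n) modulus (C k i j) <= 1) ->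
    (forall k j, \sum_(i < n) modulus (C k i j) <= 1) ->
    96 * (size ks)%:R <= e ^+ 4 * n%:R ^+ 2 ->
  exists theta : nat -> R, (forall i, theta i = 1 \/ theta i = -1) /\
    forall k, k \in ks ->
      modulus (\sum_(i < n) \sum_(j < n) C k i j * (theta i)%:C * (theta j)%:C) <=
      2 * e * n%:R.
Proof.
move=> e0 C0 Crow Ccol nlarge.
pose part (b : bool) (z : R[i]) := if b then complex.Re z else complex.Im z.
have part_le b z : `|part b z| <= modulus z.
  by case: b; [exact: normr_Re_le | exact: normr_Im_le].
pose ks2 := [seq (k, b) | k <- ks, b <- [:: true; false]].
have [|||theta [theta1 thetaP]] :=
    @ex_signs _ ks2 (fun kb i j => part kb.2 (C kb.1 i j)) n.
- by case=> k b i /=; rewrite C0 /part; case: b.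
- by case=> k b i /=; apply: le_trans (Crow k i); apply: ler_sum => j _.
- by case=> k b i /=; apply: le_trans (Ccol k i); apply: ler_sum => j _.
exists theta; split => // k kks.
have thetaB b : `|part b (\sum_(i < n) \sum_(j < n) C k i j * (theta i)%:C * (theta j)%:C)| <= e * n%:R.
  have kb : (k, b) \in ks2 by apply/allpairsP; exists (k, b); split => //; case: (b).
  have := thetaP _ kb; set q := quad_form _ _ _.
  have -> : part b (\sum_(i < n) \sum_(j < n) C k i j * (theta i)%:C * (theta j)%:C) = q.
    have partM z (u v : R) : part b (z * u%:C * v%:C) = part b z * u * v.
      by rewrite /part; case: (b); case: z => x y /=; ring.
    have part_sum (F : 'I_n -> R[i]) : part b (\sum_(i < n) F i) = \sum_(i < n) part b (F i).
      by rewrite /part; case: (b); rewrite raddf_sum.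
    rewrite part_sum; apply: eq_bigr => i _.
    by rewrite part_sum; apply: eq_bigr => j _; rewrite partM.
  move=> qle; rewrite -(@ler_pXn2r _ 4) ?nnegrE ?mulr_ge0 //.
  rewrite -normrX ger0_norm ?exprn_even_ge0 //; apply: le_trans qle _.
  rewrite exprMn (_ : n%:R ^+ 4 = n%:R ^+ 2 * n%:R ^+ 2); last by rewrite -exprD.
  rewrite mulrA.
  rewrite ler_wpM2r ?sqr_ge0 //; apply: le_trans nlarge.
  rewrite size_allpairs /= natrM; lra.
apply: le_trans (modulus_le_ReIm _) _.
by have := thetaB true; have := thetaB false; rewrite /part; lra.
Qed.

End Signs.

(** * The Fourier matrix with signed rows *)

Section Fourier.
Context {R : realType}.

(** X^n - 1 splits over the algebraically closed field R[i] and is separable in characteristic 0. It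
    thus has n distinct roots, one of which is primitive. *)
Lemma ex_prim_root (n : nat) : (0 < n)%N -> exists z : R[i], n.-primitive_root z.
Proof.
move=> n0; pose p : {poly R[i]} := 'X^n - 1.
have [r Dp] := closed_field_poly_normal p; rewrite (monicP _) in Dp; last first.
  by rewrite monicXnsubC.
rewrite scale1r in Dp.
have rn1 : all n.-unity_root r by apply/allP=> z; rewrite -root_prod_XsubC -Dp.
have sz_r : (n < (size r).+1)%N.
  by rewrite -(size_prod_XsubC r id) -Dp size_XnsubC.
have [|z] := hasP (has_prim_root n0 rn1 _ sz_r); last by exists z.
rewrite -separable_prod_XsubC -Dp separable_Xn_sub_1 // pnatr_eq0 -lt0n //.
Qed.


Variables (n : nat) (w : R[i]) (theta : nat -> R).
Hypothesis n_gt0 : (0 < n)%N.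
Hypothesis w_prim : n.-primitive_root w.
Hypothesis theta1 : forall i, theta i = 1 \/ theta i = -1.

Definition fourier (i l : nat) : R[i] :=
  (Num.sqrt n%:R)^-1%:C * (theta i)%:C * w ^+ (i * l).

Lemma prim_root_unit : w != 0.
Proof.
by apply: contra_eqN (prim_expr_order w_prim) => /eqP->; rewrite expr0n gtn_eqF // eq_sym oner_eq0.
Qed.

Lemma prim_root_conj : w^* = w^-1.
Proof.
have w1 : `|w| = 1.
  apply/eqP; rewrite -(@pexpr_eq1 _ _ n) // -normrX (prim_expr_order w_prim).
  by rewrite normr1.
apply: (mulfI prim_root_unit); rewrite mulfV ?prim_root_unit //.
by rewrite -normCK w1 expr1n.
Qed.

Lemma sum_prim_root (i k : nat) : (i < n)%N -> (k < n)%N ->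
  \sum_(l < n) w ^+ (i * l) * (w^-1) ^+ (k * l) = (n * (i == k))%:R.
Proof.
move=> ilt klt; pose z := w ^+ i * w^-1 ^+ k.
have zE (l : nat) : w ^+ (i * l) * (w^-1) ^+ (k * l) = z ^+ l.
  by rewrite !exprM -exprMn.
under eq_bigr do rewrite zE.
have [ik|ik] := eqVneq i k.
  have -> : z = 1 by rewrite /z ik -exprMn mulfV ?expr1n ?prim_root_unit.
  by under eq_bigr do rewrite expr1n; rewrite sumr_const card_ord muln1.
have z1 : z != 1.
  apply: contraNneq ik => z1.
  have : w ^+ i = w ^+ k.
    have := congr1 (fun u => u * w ^+ k) z1; rewrite /z -mulrA -exprMn mulVf ?prim_root_unit //.
    by rewrite expr1n mulr1 mul1r.
  by move/eqP; rewrite (eq_prim_root_expr w_prim) !modn_small.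
have zn : z ^+ n = 1.
  by rewrite /z exprMn exprAC (prim_expr_order w_prim) expr1n mul1r exprAC exprVn
    (prim_expr_order w_prim) invr1 expr1n.
rewrite muln0; apply/eqP; have := subrX1 z n; rewrite zn subrr => /esym/eqP.
by rewrite mulf_eq0 subr_eq0 (negbTE z1).
Qed.

Lemma sqrt_invn : (Num.sqrt n%:R)^-1%:C * (Num.sqrt n%:R)^-1%:C = n%:R^-1 :> R[i].
Proof.
rewrite -rmorphM /= -invfM -expr2 sqr_sqrtr // fmorphV.
by rewrite rmorph_nat.
Qed.

Lemma theta_sqr i : (theta i)%:C * (theta i)%:C = 1.
Proof. by rewrite -rmorphM; case: (theta1 i) => ->; rewrite ?mulrNN mulr1. Qed.

Lemma fourier_conj i l :
  (fourier i l)^* = (Num.sqrt n%:R)^-1%:C * (theta i)%:C * w^-1 ^+ (i * l).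
Proof.
rewrite -prim_root_conj /fourier rmorphM rmorphM rmorphXn /=.
by congr (_ * _ * _); exact: conjc_real.
Qed.

Lemma fourier_rows (i k : nat) : (i < n)%N -> (k < n)%N ->
  \sum_(l < n) fourier i l * (fourier k l)^* = (i == k)%:R.
Proof.
move=> ilt klt.
under eq_bigr do rewrite fourier_conj /fourier mulrACA.
rewrite -mulr_sumr sum_prim_root // mulrACA sqrt_invn.
have [<-|] := eqVneq; last by rewrite muln0 mulr0.
by rewrite theta_sqr mulr1 muln1 mulVf // pnatr_eq0 -lt0n.
Qed.

Lemma fourier_cols (h k : nat) : (h < n)%N -> (k < n)%N ->
  \sum_(i < n) (fourier i h)^* * fourier i k = (h == k)%:R.
Proof.
move=> hlt klt.
have FE (i : nat) : (fourier i h)^* * fourier i k =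
    n%:R^-1 * (w ^+ (k * i) * w^-1 ^+ (h * i)).
  rewrite fourier_conj /fourier mulrACA [X in X * _]mulrACA sqrt_invn theta_sqr mulr1.
  by rewrite [X in _ * X]mulrC (mulnC h) (mulnC k).
under eq_bigr do rewrite FE.
rewrite -mulr_sumr sum_prim_root // eq_sym.
have [_|] := eqVneq; last by rewrite muln0 mulr0.
by rewrite muln1 mulVf // pnatr_eq0 -lt0n.
Qed.

(** Separates signs from phases: a compressed term becomes 1/n times a quadratic form in [theta]. *)
Lemma fourier_mul (i j l : nat) : (fourier i l)^* * fourier j l =
  n%:R^-1 * (((w ^+ (i * l))^* * w ^+ (j * l)) * (theta i)%:C * (theta j)%:C).
Proof.
rewrite fourier_conj /fourier rmorphXn /= prim_root_conj -sqrt_invn; ring.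
Qed.

Lemma modulus_prim_root (k : nat) : modulus (w ^+ k) = 1.
Proof.
apply: complexI; rewrite modulusE normrX.
have -> : `|w| = 1.
  apply/eqP; rewrite -(@pexpr_eq1 _ _ n) // -normrX (prim_expr_order w_prim).
  by rewrite normr1.
by rewrite expr1n.
Qed.

Lemma modulus_fourier_mul (i j l : nat) :
  modulus ((fourier i l)^* * fourier j l) = n%:R^-1.
Proof.
rewrite fourier_mul !modulusM modulus_conj !modulus_prim_root !modulus_real !mul1r.
have -> : modulus (n%:R^-1 : R[i]) = n%:R^-1.
  rewrite -(rmorph_nat (real_complex R)) -fmorphV modulus_real ger0_norm //.
by case: (theta1 i) (theta1 j) => -> [|] ->; rewrite ?normrN normr1 !mulr1.
Qed.

Lemma fourier_self (i l : nat) : (fourier i l)^* * fourier i l = n%:R^-1.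
Proof.
rewrite fourier_mul -mulrA theta_sqr mulr1 [_^* * _]mulrC.
by rewrite -modulus_sqr modulus_prim_root expr1n mulr1.
Qed.

End Fourier.

(** * Locally constant functions and clopen sets *)

Definition locally_constant (T : Type) (f : cantor_space -> T) : Prop :=
  forall x, \forall y \near x, f y = f x.

Section LocallyConstant.
Local Notation X := cantor_space.

Lemma locally_constant_comp (T T' : Type) (f : X -> T) (g : T -> T') :
  locally_constant f -> locally_constant (g \o f).
Proof. by move=> lf x; have := lf x; apply: filterS => y /= ->. Qed.

Lemma locally_constant_clopen (T : Type) (f : X -> T) (P : set T) :
  locally_constant f -> clopen (f @^-1` P).
Proof.
move=> lf; have op (Q : set T) : open (f @^-1` Q).
  by rewrite openE => x Qx; apply: (@filterS _ _ _ _ _ _ (lf x)) => y /= ->.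
by split => //; rewrite -[_ @^-1` _]setCK; exact/open_closedC/(op (~` P)).
Qed.

Lemma clopen_near (U : set X) (x : X) : clopen U -> \forall y \near x, U y = U x.
Proof.
move=> [Uo Uc]; have [xU|xU] := pselect (U x).
  have : nbhs x U by exact: open_nbhs_nbhs.
  by apply: filterS => y yU; apply/propext; split.
have : nbhs x (~` U) by apply: open_nbhs_nbhs; split => //; exact: closed_openC.
by apply: filterS => y yU; apply/propext; split.
Qed.

Lemma near_all_seq (I : eqType) (s : seq I) (x : X) (P : I -> X -> Prop) :
  (forall i, i \in s -> \forall y \near x, P i y) ->
  \forall y \near x, forall i, i \in s -> P i y.
Proof.
elim: s => [|i s IH] Ps; first by apply: (@nearW _ (nbhs x)) => y j; rewrite in_nil.
have Pi := Ps i (mem_head _ _).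
have /IH Pt : forall j, j \in s -> \forall y \near x, P j y.
  by move=> j js; apply: Ps; rewrite inE js orbT.
near=> y => j; rewrite inE => /orP[/eqP ->|]; first by near: y.
by move: j; near: y.
Unshelve. all: by end_near. Qed.

Lemma cantor_cover_compact : @cover_compact X setT.
Proof. by rewrite -compact_cover; exact: cantor_space_compact. Qed.

Lemma locally_constant_finite (T : choiceType) (f : X -> T) :
  locally_constant f -> exists s : seq T, forall x, f x \in s.
Proof.
move=> lf; have [t _||s _ sf] := @cantor_cover_compact T setT (fun t => f @^-1` [set t]).
- by have [] := locally_constant_clopen [set t] lf.
- by move=> x _; exists (f x).
by exists s => x; have [t ts /= ->] := sf x I.
Qed.

Lemma locally_constant_continuous (R : realType) (f : X -> R[i]) :
  locally_constant f -> continuous (f : X -> R[i]^o).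
Proof. by move=> lf x; apply: (@cvg_near_cst _ R[i]^o); exact: lf. Qed.

Lemma clopenD (U V : set X) : clopen U -> clopen V -> clopen (U `\` V).
Proof. by move=> cU cV; rewrite setDE; apply: clopenI => //; exact: clopenC. Qed.

Lemma clopen_bigcup_ord n (P : 'I_n -> set X) : (forall i, clopen (P i)) ->
  clopen (\bigcup_i P i).
Proof.
move=> cP; split; first by apply: bigcup_open => i _; have [] := cP i.
by apply: closed_bigcup => [|i _]; [exact: finite_finset | have [] := cP i].
Qed.

(** A has no isolated point, hence a second point, and zero-dimensionality separates the two by a
    clopen set. *)
Lemma clopen_split (A : set X) : clopen A -> A !=set0 ->
  exists B, [/\ clopen B, B `<=` A, B !=set0 & (A `\` B) !=set0].
Proof.
move=> cA [x Ax].
have [_ /seteqP[_ /(_ x I)]] := cantor_perfect.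
move=> /(_ A) [|y [yx _ Ay]]; first by apply: open_nbhs_nbhs; split => //; have [] := cA.
have [U [cU Ux Uy]] := cantor_zero_dimensional yx.
exists (A `&` U); split; first exact: clopenI.
- by move=> z [].
- by exists y.
- by exists x; split => // -[].
Qed.

End LocallyConstant.

(* In [tower_over act A C L] the points [act h x], for [x \in A] and [h \in L x],
   enumerate [C] without repetition; for [C] the whole space, [L] is a [castle]. *)
Record tower_over (G : groupType) (act : G -> cantor_space -> cantor_space)
    (A C : set cantor_space) (L : cantor_space -> seq G) : Prop := TowerOver {
  tower_lc : locally_constant L;
  tower_out : forall x, ~ A x -> L x = [::];
  tower_uniq : forall x, uniq (L x);
  tower_inj : forall x y h k, h \in L x -> k \in L y ->
    act h x = act k y -> x = y /\ h = k;
  tower_image : forall y, C y <-> exists x h, h \in L x /\ act h x = y }.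

(** * Stacking towers, and towers of height at most one *)

Section Towers.
Context {G : groupType}.
Local Notation X := cantor_space.
Variable act : G -> X -> X.
Hypothesis act_action : is_action act.

Lemma tower_cat (A C1 C2 : set X) L1 L2 : C1 `&` C2 = set0 ->
  tower_over act A C1 L1 -> tower_over act A C2 L2 ->
  tower_over act A (C1 `|` C2) (fun x => L1 x ++ L2 x).
Proof.
move=> C12 T1 T2.
have disj x y h k : h \in L1 x -> k \in L2 y -> act h x = act k y -> False.
  move=> hx ky hk; suff : (C1 `&` C2) (act h x) by rewrite C12.
  split; first by apply/(tower_image T1); exists x, h.
  by rewrite hk; apply/(tower_image T2); exists y, k.
split.
- move=> x; near=> y; congr (_ ++ _); near: y; [exact: (tower_lc T1)|exact: (tower_lc T2)].
- by move=> x Ax; rewrite (tower_out T1 Ax) (tower_out T2 Ax).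
- move=> x; rewrite cat_uniq (tower_uniq T1) (tower_uniq T2) andbT /=.
  by apply/hasPn => h h2; apply/negP => h1; exact: (disj x x h h).
- move=> x y h k; rewrite !mem_cat => /orP[hx|hx] /orP[ky|ky] hk.
  + exact: (tower_inj T1).
  + by have := disj _ _ _ _ hx ky hk.
  + by have := disj _ _ _ _ ky hx (esym hk).
  + exact: (tower_inj T2).
- move=> y; split.
    move=> [/(tower_image T1)|/(tower_image T2)] [x [h [hx hy]]];
    by exists x, h; rewrite mem_cat hx ?orbT.
  move=> [x [h [+ hy]]]; rewrite mem_cat => /orP[hx|hx]; [left|right].
    by apply/(tower_image T1); exists x, h.
  by apply/(tower_image T2); exists x, h.
Unshelve. all: by end_near. Qed.

Lemma act_image_preimage g (B : set X) : act g @` B = act g^-1%g @^-1` B.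
Proof.
apply/seteqP; split => [_ [x Bx <-]|y By] /=; first by rewrite actK.
by exists (act g^-1%g y) => //; rewrite actKV.
Qed.

Lemma clopen_act g (B : set X) : clopen B -> clopen (act g @` B).
Proof.
move=> cB; rewrite act_image_preimage; apply: preimage_clopen => //.
exact: act_cont.
Qed.

(** Turns a piecewise translation, as supplied by comparison, into a tower of height at most one. *)
Definition pieces_tower n (P : 'I_n -> set X) (g : 'I_n -> G) (x : X) : seq G :=
  if [pick j | `[< P j x >]] is Some j then [:: g j] else [::].

Lemma pieces_tower_mem n (P : 'I_n -> set X) g x j : trivIset setT P ->
  P j x -> pieces_tower P g x = [:: g j].
Proof.
move=> tP Pj; rewrite /pieces_tower; case: pickP => [i /asboolP Pi|/(_ j)].
  have -> // : i = j by apply: (tP) => //; exists x.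
by rewrite asboolT.
Qed.

Lemma pieces_towerP n (P : 'I_n -> set X) g (A : set X) :
  (forall j, clopen (P j)) -> trivIset setT P ->
  trivIset setT (fun j => act (g j) @` P j) -> \bigcup_j P j `<=` A ->
  tower_over act A (\bigcup_j (act (g j) @` P j)) (pieces_tower P g).
Proof.
move=> cP tP tgP PA.
have memP x h : h \in pieces_tower P g x -> exists2 j, P j x & h = g j.
  rewrite /pieces_tower; case: pickP => // j /asboolP Pj.
  by rewrite inE => /eqP ->; exists j.
split.
- move=> x.
  have : \forall y \near x, forall j, j \in enum 'I_n -> P j y = P j x.
    by apply: near_all_seq => j _; exact: clopen_near.
  apply: filterS => y PE; rewrite /pieces_tower.
  rewrite (@eq_pick _ (fun j => `[< P j y >]) (fun j => `[< P j x >])) // => j.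
  by rewrite PE // mem_enum.
- move=> x Ax; rewrite /pieces_tower; case: pickP => // j /asboolP Pj.
  by exfalso; apply/Ax/PA; exists j.
- by move=> x; rewrite /pieces_tower; case: pickP.
- move=> x y h k /memP[i Pi ->] /memP[j Pj ->] ij.
  have ijE : i = j.
    by apply: (tgP) => //; exists (act (g i) x); split; [exists x|rewrite ij; exists y].
  split; last by rewrite ijE.
  by apply: (can_inj (actK act_action (g i))); rewrite ij ijE.
- move=> y; split.
    move=> [j _ [x Pj <-]]; exists x, (g j); split => //.
    by rewrite (pieces_tower_mem _ tP Pj) mem_head.
  by move=> [x [h [/memP[j Pj ->] <-]]]; exists j => //; exists x.
Qed.

Lemma size_pieces_tower n (P : 'I_n -> set X) g x : (size (pieces_tower P g x) <= 1)%N.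
Proof. by rewrite /pieces_tower; case: pickP. Qed.

End Towers.

(** * Packing clopen sets by copies of a small clopen set *)

Definition real_measure (R : realType) (mu : probability borel_cantor R)
  (U : set cantor_space) : R := fine (mu (U : set borel_cantor)).

Section Packing.
Context {R : realType} {G : groupType}.
Local Notation X := cantor_space.
Variables (act : G -> X -> X) (mu : probability borel_cantor R).
Hypothesis act_action : is_action act.
Hypothesis act_minimal : minimal_action act.
Hypothesis mu_inv : invariant_measure act mu.

Local Notation m := (real_measure mu).

Lemma mu_clopenE (U : set X) : clopen U -> mu U = (m U)%:E.
Proof.
by move=> cU; rewrite /real_measure fineK // fin_num_measure //; exact: clopen_measurable.
Qed.

Lemma real_measure_ge0 (U : set X) : 0 <= m U.
Proof. by rewrite /real_measure fine_ge0. Qed.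

Lemma real_measure_setT : m setT = 1.
Proof. by have /(congr1 fine) := probability_setT mu. Qed.

Lemma real_measure_setU (U V : set X) : clopen U -> clopen V -> U `&` V = set0 ->
  m (U `|` V) = m U + m V.
Proof.
move=> cU cV UV; apply: EFin_inj; rewrite EFinD -!mu_clopenE //; last exact: clopenU.
by rewrite measureU //; exact: clopen_measurable.
Qed.

Lemma real_measure_setD (U V : set X) : clopen U -> clopen V -> V `<=` U ->
  m (U `\` V) = m U - m V.
Proof.
move=> cU cV VU; have {2}-> : U = V `|` (U `\` V) by rewrite setDUK.
rewrite real_measure_setU ?setDIK //; first by rewrite addrC addKr.
exact: clopenD.
Qed.

(** The points whose orbit misses U form a closed invariant set different from X, hence an empty one
    by minimality. So finitely many translates of U cover X, and they cannot all be null. *)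
Lemma real_measure_gt0 (U : set X) : open U -> U !=set0 -> 0 < m U.
Proof.
move=> Uo [x Ux]; rewrite lt_def real_measure_ge0 andbT; apply/eqP => mU.
have Um : measurable (U : set borel_cantor) by exact: sub_sigma_algebra.
have mu0 : mu U = 0%E.
  by rewrite -[LHS]fineK ?fin_num_measure // -/(m U) mU.
have pre_open g : open (act g @^-1` U).
  by move/continuousP: (@act_cont _ _ act_action g); apply.
pose Y := ~` \bigcup_(g in setT) (act g @^-1` U).
have [|g y [y0 Yy0 <-] [h _ hU]|Y0|YT] := act_minimal (Y := Y).
- by apply: open_closedC; apply: bigcup_open => g _; exact: pre_open.
- by apply: Yy0; exists (h * g)%g => //=; rewrite actM.
- have [g _|y _|s _ sX] := @cantor_cover_compact G setT (fun g => act g @^-1` U).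
  + exact: pre_open.
  + by apply: contrapT => yU; have : Y y by []; rewrite Y0.
  + have null (r : seq G) : let V := \big[setU/set0]_(g <- r) (act g @^-1` U) in
        measurable (V : set borel_cantor) /\ mu V = 0%E.
      elim: r => [|g r [IHm IH]] /=; first by rewrite big_nil; split => //; exact: measure0.
      have gm : measurable (act g @^-1` U : set borel_cantor) by exact: sub_sigma_algebra.
      rewrite big_cons; split; first exact: measurableU.
      by apply: null_set_setU => //; rewrite -[RHS]mu0; exact: mu_inv.
    have [_] := null (enum_fset s).
    have -> : \big[setU/set0]_(g <- enum_fset s) (act g @^-1` U) = setT.
      apply/seteqP; split => // y _; have [g gs gU] := sX y I.
      by rewrite -bigcup_seq; exists g.
    by move/eqP; rewrite probability_setT onee_eq0.
- have : Y x by rewrite YT.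
  by apply; exists 1%g => //=; rewrite act1.
Qed.

(** Starting from X, a nonempty clopen set is split repeatedly and the lighter part is kept. *)
Lemma ex_small_clopen (d : R) : 0 < d ->
  exists A : set X, [/\ clopen A, A !=set0 & m A <= d].
Proof.
move=> d0; suff halve (k : nat) : exists A : set X, [/\ clopen A, A !=set0 & m A * 2 ^+ k <= 1].
  have [k kd] : exists k : nat, d^-1 <= 2 ^+ k.
    exists (Num.bound d^-1); apply: (@le_trans _ _ (Num.bound d^-1)%:R).
      by apply: ltW; apply: archi_boundP; rewrite invr_ge0 ltW.
    by rewrite -natrX ler_nat ltnW // ltn_expl.
  have [A [cA A0 Ak]] := halve k; exists A; split => //.
  have := le_trans (ler_wpM2l (real_measure_ge0 A) kd) Ak.
  by rewrite ler_pdivrMr // mul1r.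
elim: k => [|k [A [cA A0 Ak]]].
  exists setT; split; [exact: clopenT|by exists point|by rewrite real_measure_setT mulr1].
have [B [cB BA B0 AB0]] := clopen_split cA A0.
have cAB := clopenD cA cB.
have := real_measure_setD cA cB BA; have := exprn_ge0 k (ltW (ltr0n R 2)); rewrite exprS.
have [BAB|/ltW BAB] := leP (m B) (m (A `\` B)) => k0 mAB.
  by exists B; split => //; nra.
by exists (A `\` B); split => //; nra.
Qed.

Hypothesis comparison : forall U V : set X, clopen U -> clopen V ->
  m U < m V -> subequivalent act U V.

Lemma real_measure_act (g : G) (B : set X) : clopen B -> m (act g @` B) = m B.
Proof.
move=> cB; rewrite /real_measure act_image_preimage // mu_inv //; exact: clopen_measurable.
Qed.

Lemma real_measure_bigcup n (P : 'I_n -> set X) : (forall j, clopen (P j)) -> trivIset setT P ->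
  m (\bigcup_j P j) = \sum_j m (P j).
Proof.
move=> cP tP.
have seqP (r : seq 'I_n) : uniq r -> let V := \big[setU/set0]_(j <- r) P j in
    clopen V /\ m V = \sum_(j <- r) m (P j).
  elim: r => [_|j r IH] /=.
    by rewrite !big_nil; split; [exact: clopen0 | rewrite /real_measure measure0].
  move=> /andP[jr /IH[cV mV]]; rewrite !big_cons -mV; split; first exact: clopenU.
  apply: real_measure_setU => //; rewrite -bigcup_seq; apply/seteqP; split => // x [Pj [i ir Pi]].
  by move: jr; rewrite (tP j i) // ?(negbTE _) ?ir //; exists x.
have [_ mE] := seqP _ (enum_uniq 'I_n).
rewrite -[RHS]big_enum /= -mE.
congr m; rewrite -bigcup_seq; apply/seteqP; split => x [j _ Pj]; exists j => //=.
by rewrite mem_enum.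
Qed.

Lemma real_measure_bigcup_act n (P : 'I_n -> set X) (g : 'I_n -> G) :
  (forall j, clopen (P j)) -> trivIset setT P ->
  trivIset setT (fun j => act (g j) @` P j) ->
  m (\bigcup_j (act (g j) @` P j)) = m (\bigcup_j P j).
Proof.
move=> cP tP tgP; rewrite !real_measure_bigcup // => [|j]; last exact: clopen_act.
by apply: eq_bigr => j _; rewrite real_measure_act.
Qed.

(** Comparison moves C piecewise into A; the inverse translations carry part of A back onto C. *)
Lemma pack_small (A C : set X) : clopen A -> clopen C -> m C < m A ->
  exists2 L, tower_over act A C L & forall x, (size (L x) <= 1)%N.
Proof.
move=> cA cC /(comparison cC cA) [n [P [g [cP tP PC tgP gPA]]]].
have gK j : act (g j)^-1%g @` (act (g j) @` P j) = P j.
  rewrite image_comp (_ : _ \o _ = id) ?image_id //.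
  by apply/funext => x /=; rewrite actK.
exists (pieces_tower (fun j => act (g j) @` P j) (fun j => (g j)^-1%g)).
  have <- : \bigcup_j (act (g j)^-1%g @` (act (g j) @` P j)) = C.
    by rewrite -PC; apply: eq_bigcupr => j _.
  apply: pieces_towerP => //.
  - by move=> j; exact: clopen_act.
  - by under eq_fun do rewrite gK.
  - by move=> x [j _ /gPA].
by move=> x; exact: size_pieces_tower.
Qed.

(** If m C = m A, comparison does not apply to C itself. C is then split into two nonempty clopen
    parts, both strictly lighter than A because nonempty open sets have positive measure. Heights
    stay between 0 and 2, within the allowed error. *)
Lemma pack_le (A C : set X) : clopen A -> A !=set0 -> clopen C -> m C <= m A ->
  exists2 L, tower_over act A C L &
    forall x, A x -> `|m A * (size (L x))%:R - m C| <= m A.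
Proof.
move=> cA A0 cC; have mA : 0 < m A by apply: real_measure_gt0 => //; case: cA.
rewrite le_eqVlt => /predU1P[mCA|mCA]; last first.
  have [L LT Ls] := pack_small cA cC mCA; exists L => // x _.
  have := Ls x; have := real_measure_ge0 C; case: (size _) => [|[|]] // C0 _; rewrite ler_norml; lra.
have C0 : C !=set0.
  by apply/set0P/eqP => CE; move: mA; rewrite -mCA CE /real_measure measure0 ltxx.
have [B [cB BC B0 CB0]] := clopen_split cC C0.
have cCB := clopenD cC cB; have mCB := real_measure_setD cC cB BC.
have mB : 0 < m B by apply: real_measure_gt0 => //; case: cB.
have mCB0 : 0 < m (C `\` B) by apply: real_measure_gt0 => //; case: cCB.
have /(pack_small cA cB)[L1 T1 s1] : m B < m A by lra.
have /(pack_small cA cCB)[L2 T2 s2] : m (C `\` B) < m A by lra.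
exists (fun x => L1 x ++ L2 x).
  by have := tower_cat (setDIK B C) T1 T2; rewrite setDUK.
move=> x _; rewrite size_cat natrD; have := s1 x; have := s2 x.
by case: (size _) => [|[|]] //; case: (size _) => [|[|]] // _ _; rewrite ler_norml; lra.
Qed.

(** As long as C is heavier than A, comparison places a full copy of A in C. The copy adds exactly
    one level over every point of A and removes m A from m C, so the deviation does not change; the
    last remainder goes to [pack_le]. *)
Lemma pack (A C : set X) : clopen A -> A !=set0 -> clopen C ->
  exists2 L, tower_over act A C L &
    forall x, A x -> `|m A * (size (L x))%:R - m C| <= m A.
Proof.
move=> cA A0 cC; have mA : 0 < m A by apply: real_measure_gt0 => //; case: cA.
have [k mCk] : exists k : nat, m C <= m A + k%:R * m A.
  exists (Num.bound (m C / m A)); apply: ler_wpDl; first exact: real_measure_ge0.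
  rewrite -ler_pdivrMr //; apply: ltW; apply: archi_boundP.
  by rewrite divr_ge0 // real_measure_ge0.
elim: k C cC mCk => [|k IH] C cC; first by rewrite mul0r addr0; exact: pack_le.
rewrite -addn1 natrD => mCk.
have [CA|AC] := leP (m C) (m A); first exact: pack_le.
have [n [P [g [cP tP PA tgP gPC]]]] := comparison cA cC AC.
pose C' := \bigcup_j (act (g j) @` P j).
have cC' : clopen C' by apply: clopen_bigcup_ord => j; exact: clopen_act.
have C'C : C' `<=` C by move=> x [j _ /gPC].
have mC' : m C' = m A by rewrite real_measure_bigcup_act // PA.
have mD := real_measure_setD cC cC' C'C.
have [|L2 T2 s2] := IH (C `\` C') (clopenD cC cC'); first by move: mCk mD; rewrite mC'; lra.
have T1 : tower_over act A C' (pieces_tower P g) by apply: pieces_towerP => //; rewrite PA.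
exists (fun x => pieces_tower P g x ++ L2 x).
  by have := tower_cat (setDIK C' C) T1 T2; rewrite setDUK.
move=> x Ax; have [j _ Pj] : (\bigcup_j P j) x by rewrite PA.
rewrite size_cat (pieces_tower_mem _ tP Pj) /= natrD.
have := s2 _ Ax; rewrite mD mC'.
by rewrite (_ : m A * (1 + _) - _ = m A * (size (L2 x))%:R - (m C - m A)) //; ring.
Qed.

(** Each class of [r] is packed separately over the common base A and the label lists are
    concatenated. The number of levels of a tower in a class is then the height of the partial tower
    packed for that class, which [pack] controls over every base point. *)
Lemma ex_castle (r : X -> X) (cs : seq X) (A : set X) :
    locally_constant r -> uniq cs -> (forall x, r x \in cs) ->
    clopen A -> A !=set0 ->
  exists tower : X -> seq G,
    [/\ locally_constant tower, castle act tower &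
      forall x h, h \in tower x -> exists N : X -> nat,
        (forall F : X -> R[i], \sum_(k <- tower x) F (r (act k x)) =
          \sum_(c <- cs) (N c)%:R * F c) /\
        forall c, c \in cs -> `|m A * (N c)%:R - m (r @^-1` [set c])| <= m A].
Proof.
move=> lr ucs rcs cA A0.
have [L LP] : exists L : X -> X -> seq G, forall c, tower_over act A (r @^-1` [set c]) (L c) /\
    forall x, A x -> `|m A * (size (L c x))%:R - m (r @^-1` [set c])| <= m A.
  have Lex c := pack cA A0 (locally_constant_clopen [set c] lr).
  pose L c := projT1 (cid2 (Lex c)).
  by exists L => c; rewrite /L; case: (cid2 _).
have catP (s : seq X) : uniq s ->
    tower_over act A (r @^-1` [set` s]) (fun x => flatten [seq L c x | c <- s]).
  elim: s => [_|c s IH].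
    rewrite (_ : r @^-1` _ = set0); last first.
      by apply/seteqP; split => // x; rewrite /= in_nil.
    by split => // [x|y]; [exact: (@nearW _ (nbhs x))|split => // -[x [h []]]].
  move=> /andP[cs' /IH Ts].
  rewrite (_ : r @^-1` _ = (r @^-1` [set c]) `|` (r @^-1` [set` s])).
    apply: tower_cat => //; last by have [] := LP c.
    apply/seteqP; split => // x [/= -> cs1].
    by rewrite cs1 in cs'.
  apply/seteqP; split => x /=; rewrite inE; first by move=> /orP[/eqP|]; [left|right].
  by move=> [->|->]; rewrite ?eqxx ?orbT.
have T := catP cs ucs.
exists (fun x => flatten [seq L c x | c <- cs]); split.
- exact: (tower_lc T).
- split; [exact: (tower_uniq T)|exact: (tower_inj T)|].
  by move=> y; apply/(tower_image T) => /=.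
move=> x h hx; have Ax : A x.
  by apply: contrapT => /(tower_out T) TE; rewrite TE in hx.
exists (fun c => size (L c x)); split; last by move=> c _; have [_] := LP c; apply.
move=> F; rewrite big_flatten /= big_map; apply: eq_bigr => c _.
rewrite (eq_big_seq (fun=> F c)).
  by rewrite big_const_seq count_predT iter_addr_0 mulr_natl.
move=> k kx; congr F; have [Tc _] := LP c.
by have : (r @^-1` [set c]) (act k x) by apply/(tower_image Tc); exists x, k.
Qed.

End Packing.

(** * Uniform approximation of continuous functions by step functions *)

Section StepApproximation.
Context {R : realType}.
Local Notation X := cantor_space.
Local Notation CX := (continuousType cantor_space R[i]^o).

(** X is covered by finitely many clopen sets [D x] on which every f stays within e of f x; [r]
    sends a point to the centre x of the first listed set containing it. *)
Lemma ex_step_approx (fs : seq CX) (e : R) : 0 < e ->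
  exists (r : X -> X) (cs : seq X),
    [/\ locally_constant r, uniq cs, forall x, r x \in cs &
      forall f, f \in fs -> forall x, modulus (f x - f (r x)) < e].
Proof.
move=> e0.
have [D DP] : exists D : X -> set X, forall x, [/\ D x x, clopen (D x) &
    forall y, D x y -> forall f, f \in fs -> modulus (f x - f y) < e].
  suff Dex x : exists D : set X, [/\ D x, clopen D &
      forall y, D y -> forall f, f \in fs -> modulus (f x - f y) < e].
    by exists (fun x => projT1 (cid (Dex x))) => x; case: (cid _).
  have fN : \forall y \near x, forall f, f \in fs -> modulus (f x - f y) < e.
    apply: near_all_seq => f _.
    have /continuous_near_modulus/(_ x _ e0) := @cts_fun _ _ f.
    by [].
  have [D [Dx cD] DN] := zero_dimensional_cvg cantor_space_hausdorff
    cantor_zero_dimensional cantor_space_compact fN.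
  by exists D; split => // y /DN.
have [x _|x _|s _ sX] := @cantor_cover_compact X setT D.
- by have [_ []] := DP x.
- by exists x => //; have [] := DP x.
(* The default [point] is never taken, because the listed sets cover X. *)
pose r y := head point [seq x <- enum_fset s | `[< D x y >]].
have rP y : r y \in enum_fset s /\ D (r y) y.
  have : r y \in [seq x <- enum_fset s | `[< D x y >]].
    have [x xs xy] := sX y I; rewrite /r.
    have : x \in [seq x <- enum_fset s | `[< D x y >]] by rewrite mem_filter asboolT.
    by case: [seq _ <- _ | _] => // z t _; exact: mem_head.
  by rewrite mem_filter => /andP[/asboolP].
exists r, (enum_fset s); split; [|exact: fset_uniq|by move=> x; have [] := rP x|].
- move=> y; have : \forall z \near y, forall x, x \in enum_fset s -> D x z = D x y.
    by apply: near_all_seq => x _; apply: clopen_near; have [] := DP x.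
  apply: filterS => z Dz; rewrite /r; congr head.
  by apply: eq_in_filter => x xs; rewrite Dz.
- move=> f ffs x; rewrite modulusB; have [_ rx] := rP x.
  by have [_ _] := DP (r x); apply.
Qed.

(** A step approximation with error 1 takes finitely many values, whose moduli are simply added. *)
Lemma ex_bound (fs : seq CX) : exists2 B : R, 0 < B &
  forall f, f \in fs -> forall x, modulus (f x) <= B.
Proof.
have [r [cs [_ _ rcs fr]]] := ex_step_approx fs ltr01.
exists (1 + \sum_(f <- fs) \sum_(c <- cs) modulus (f c)).
  rewrite ltr_wpDr // sumr_ge0 // => f _.
  by rewrite sumr_ge0 // => c _; exact: modulus_ge0.
move=> f ffs x; rewrite -[f x](subrK (f (r x))).
apply: le_trans (ler_modulusD _ _) (lerD (ltW (fr _ ffs x)) _).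
rewrite (big_rem _ ffs) /= (big_rem _ (rcs x)) /= -addrA lerDl addr_ge0 //.
  by rewrite sumr_ge0 // => c _; exact: modulus_ge0.
by rewrite sumr_ge0 // => g _; rewrite sumr_ge0 // => c _; exact: modulus_ge0.
Qed.

End StepApproximation.

(** * Signs along a single tower *)

Section TowerMatrix.
Context {R : realType} {G : groupType}.
Local Notation X := cantor_space.
Local Notation CX := (continuousType cantor_space R[i]^o).

Lemma sum_index (T : eqType) (s : seq T) (F : nat -> R[i]) : uniq s ->
  \sum_(j <- s) F (index j s) = \sum_(l < size s) F l.
Proof.
move=> us; case: s us => [|a s] us; first by rewrite big_nil big_ord0.
rewrite (big_nth a) big_mkord; apply: eq_bigr => i _.
by rewrite index_uniq.
Qed.

Lemma sum_nth_eq (T : eqType) (a v : T) (s : seq T) : uniq s ->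
  \sum_(i < size s) (nth a s i == v)%:R <= 1 :> R.
Proof.
move=> us; rewrite -(big_mkord xpredT (fun i => (nth a s i == v)%:R)).
rewrite -(big_nth a xpredT (fun j => (j == v)%:R)).
have -> : \sum_(j <- s) (j == v)%:R = (count_mem v s)%:R :> R.
  elim: s {us} => [|x s IH]; first by rewrite big_nil.
  by rewrite big_cons IH /= natrD.
by rewrite count_uniq_mem // lern1 leq_b1.
Qed.

Definition tower_matrix (w : R[i]) (theta : nat -> R) (s : seq G) (h k : G) : R[i] :=
  fourier (size s) w theta (index h s) (index k s).

(** There is one form for each pair of a term f u_g and a column l. Its entry (i, j) can be nonzero
    only if the labels satisfy h_i = g h_j: at most one entry in each row and column, none on the
    diagonal as g <> 1. With size ps * n forms the demand 96 * (number of forms) <= e^4 n^2 loses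
    one factor n. The list [rs] holds the representatives met along the tower. *)
Lemma ex_tower_signs (ps : seq (CX * G)) (B e : R) (w : R[i]) (s : seq G) (rs : seq X) :
    0 < B -> 0 <= e -> (forall p, p \in ps -> forall x, modulus (p.1 x) <= B) ->
    (0 < size s)%N -> (size s).-primitive_root w -> uniq s ->
    96 * (size ps)%:R <= e ^+ 4 * (size s)%:R ->
  exists theta : nat -> R, (forall i, theta i = 1 \/ theta i = -1) /\
    forall p, p \in ps -> p.2 != 1%g -> forall l, l \in s ->
      modulus (\sum_(j <- s | (p.2^-1 * j)%g \in s)
        (tower_matrix w theta s j l)^* * p.1 (nth point rs (index j s)) *
        tower_matrix w theta s (p.2^-1 * j)%g l) <= 2 * e * B.
Proof.
move=> B0 e0 pB n0 wP us nlarge; set n := size s.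
(* Division by B normalises the entries to modulus at most 1. The membership tests make the row,
   column and diagonal conditions hold for every index k, not only for the listed ones. *)
pose C (k : (CX * G) * nat) (i j : nat) : R[i] :=
  if [&& k.1 \in ps, k.1.2 != 1%g & nth 1%g s i == k.1.2 * nth 1%g s j]%g
  then (w ^+ (i * k.2))^* * w ^+ (j * k.2) * (k.1.1 (nth point rs i) / B%:C)
  else 0.
have CB k i j : modulus (C k i j) <= 1.
  rewrite /C; case: ifP => [/and3P[kps _ _]|_]; last by rewrite modulus0.
  rewrite !modulusM modulus_conj !(modulus_prim_root n0 wP) !mul1r.
  rewrite -fmorphV modulus_real ger0_norm ?invr_ge0 ?(ltW B0) // ler_pdivrMr // mul1r.
  exact: pB.
have [||||theta [theta1 thetaP]] :=
    @ex_signs_complex _ _ [seq (p, l) | p <- ps, l <- iota 0 n] C n e e0.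
- move=> [[f g] l] i; rewrite /C /=; case: ifP => // /and3P[_ g1].
  by rewrite -[X in X == _]mul1g (inj_eq (mulIg _)) eq_sym (negbTE g1).
- move=> k i; apply: le_trans (sum_nth_eq 1%g (k.1.2^-1 * nth 1%g s i)%g us).
  apply: ler_sum => j _; case: eqP => [_|jn]; first exact: CB.
  rewrite /C; case: ifP => [/and3P[_ _ /eqP ij]|_]; last by rewrite modulus0.
  by case: jn; rewrite ij mulKg.
- move=> k j; apply: le_trans (sum_nth_eq 1%g (k.1.2 * nth 1%g s j)%g us).
  apply: ler_sum => i _; case: eqP => [_|jn]; first exact: CB.
  by rewrite /C; case: ifP => [/and3P[_ _ /eqP ij]|_]; rewrite ?modulus0.
- rewrite size_allpairs size_iota natrM mulrA expr2 mulrA ler_wpM2r //.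
exists theta; split => // p pps p1 l ls.
have lidx : (index l s < n)%N by rewrite index_mem.
have /thetaP : (p, index l s) \in [seq (p, l) | p <- ps, l <- iota 0 n].
  by apply/allpairsP; exists (p, index l s); rewrite mem_iota.
set Q := \sum_(i < n) _ => Qle.
suff -> : \sum_(j <- s | (p.2^-1 * j)%g \in s)
    (tower_matrix w theta s j l)^* * p.1 (nth point rs (index j s)) *
    tower_matrix w theta s (p.2^-1 * j)%g l = (B / n%:R)%:C * Q.
  rewrite modulusM modulus_real ger0_norm ?divr_ge0 ?(ltW B0) //.
  rewrite mulrAC ler_pdivrMr ?ltr0n //.
  by have := ler_wpM2l (ltW B0) Qle; lra.
rewrite /Q mulr_sumr big_mkcond /= (big_nth 1%g) big_mkord; apply: eq_bigr => i _.
have BB : B%:C != 0 :> R[i] by rewrite (inj_eq (@complexI R)) gt_eqF.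
rewrite index_uniq //; case: ifP => [gs|gs].
  have glt : (index (p.2^-1 * nth 1%g s i)%g s < n)%N by rewrite index_mem.
  rewrite (bigD1 (Ordinal glt)) //= [X in _ + X]big1 => [|j jn].
    rewrite addr0 /C pps p1 /= nth_index // mulVKg eqxx.
    rewrite /tower_matrix index_uniq // mulrAC.
    rewrite fourier_mul //.
    rewrite rmorphM fmorphV /= rmorph_nat; field.
    by rewrite BB pnatr_eq0 -lt0n.
  rewrite /C; case: ifP => [/and3P[_ _ /eqP ij]|_]; last by rewrite !mul0r.
  by move: jn; rewrite -val_eqE /= ij mulKg index_uniq // eqxx.
rewrite big1 ?mulr0 // => j _; rewrite /C; case: ifP => [/and3P[_ _ /eqP ij]|_].
  by move: gs; rewrite ij mulKg mem_nth.
by rewrite !mul0r.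
Qed.

End TowerMatrix.

(** Summing the errors over the K classes gives |a n - 1| <= K a. Then N_c / n - q_c = (N_c / n) (1
    - a n) + (a N_c - q_c) is at most (K + 1) a in absolute value, as N_c <= n. *)
Lemma proportion_average (R : realType) (T : eqType) (cs : seq T) (N : T -> nat)
    (q : T -> R) (a B : R) (F : T -> R[i]) :
    0 < a -> 0 <= B -> \sum_(c <- cs) q c = 1 ->
    (forall c, c \in cs -> `|a * (N c)%:R - q c| <= a) ->
    (forall c, c \in cs -> modulus (F c) <= B) ->
    let n := (\sum_(c <- cs) N c)%N in let K : R := (size cs)%:R in
    (0 < n)%N ->
  1 - K * a <= a * n%:R /\
  modulus (n%:R^-1 * (\sum_(c <- cs) (N c)%:R * F c) - \sum_(c <- cs) (q c)%:C * F c)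
    <= K * (K + 1) * a * B.
Proof.
move=> a0 B0 q1 aN FB n K n0.
have nR : 0 < n%:R :> R by rewrite ltr0n.
have sumK (u : T -> R) (b : R) : (forall c, c \in cs -> u c <= b) ->
    \sum_(c <- cs) u c <= K * b.
  move=> ub; apply: (@le_trans _ _ (\sum_(c <- cs) b)); first by rewrite big_seq [leRHS]big_seq; exact: ler_sum.
  by rewrite big_const_seq count_predT iter_addr_0 mulr_natl.
have an1 : `|a * n%:R - 1| <= K * a.
  rewrite -[X in _ - X]q1 /n natr_sum mulr_sumr -sumrB.
  by apply: le_trans (ler_norm_sum _ _ _) _; exact: sumK.
split; first by move: an1; rewrite ler_norml; lra.
rewrite mulr_sumr -sumrB; apply: le_trans (modulus_sum _ _ _) _.
rewrite -!mulrA mulrA -[leRHS]mulrA; apply: sumK => c ccs.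
have -> : n%:R^-1 * ((N c)%:R * F c) - (q c)%:C * F c =
    (n%:R^-1 * (N c)%:R - q c)%:C * F c.
  by rewrite rmorphB rmorphM fmorphV /= !rmorph_nat; ring.
rewrite modulusM modulus_real mulrA; apply: ler_pM => //; last exact: FB.
  exact: modulus_ge0.
have -> : n%:R^-1 * (N c)%:R - q c =
    (n%:R^-1 * (N c)%:R) * (1 - a * n%:R) + (a * (N c)%:R - q c).
  by field; rewrite gt_eqF.
apply: le_trans (ler_normD _ _) _; rewrite mulrDl mul1r; apply: lerD; last exact: aN.
rewrite normrM distrC; apply: le_trans an1; rewrite ler_piMl //.
rewrite ger0_norm ?mulr_ge0 ?invr_ge0 // mulrC ler_pdivrMr // mul1r ler_nat.
by rewrite /n (big_rem _ ccs) /= leq_addr.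
Qed.

(** * Integrals of step functions *)

Section Averaging.
Context {R : realType} {G : groupType}.
Local Notation X := cantor_space.
Local Notation CX := (continuousType cantor_space R[i]^o).
Local Notation H := (ell2 R (G * X)%type).
Variables (act : G -> X -> X) (mu : probability borel_cantor R).
Hypothesis act_action : is_action act.
Hypothesis act_minimal : minimal_action act.
Hypothesis mu_inv : invariant_measure act mu.
Hypothesis comparison : forall U V : set X, clopen U -> clopen V ->
  real_measure mu U < real_measure mu V -> subequivalent act U V.

Definition crossed_term (p : CX * G) (xi : H) : H :=
  multiplier act p.1 (translation p.2 xi).

Lemma integral_state_step (f : X -> R[i]) (r : X -> X) (cs : seq X) :
    locally_constant r -> uniq cs -> (forall x, r x \in cs) ->
  integral_state mu (f \o r) = \sum_(c <- cs) (real_measure mu (r @^-1` [set c]))%:C * f c.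
Proof.
move=> lr ucs rcs.
have -> : f \o r = (fun x => \sum_(c <- cs) f c * (\1_(r @^-1` [set c]) x)%:C).
  apply/funext => x; rewrite (big_rem _ (rcs x)) /= indicE mem_set // mulr1.
  rewrite big_seq big1 ?addr0 // => c; rewrite mem_rem_uniq // !inE => /andP[cx _].
  by rewrite indicE memNset ?mulr0 // => /= rc; rewrite rc eqxx in cx.
elim: cs {ucs rcs} => [|c cs IH].
  by under eq_fun do rewrite big_nil; rewrite big_nil integral_state0.
under eq_fun do rewrite big_cons; rewrite big_cons integral_stateD ?IH.
- by rewrite integral_state_indic //; exact: locally_constant_clopen.
- apply: locally_constant_continuous.
  exact: (@locally_constant_comp _ _ r (fun y => f c * (\1_[set c] y)%:C)).
- apply: locally_constant_continuous.
  exact: (@locally_constant_comp _ _ r (fun y => \sum_(j <- cs) f j * (\1_[set j] y)%:C)).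
Qed.

Lemma sum_preimage (r : X -> X) (cs : seq X) :
    locally_constant r -> uniq cs -> (forall x, r x \in cs) ->
  \sum_(c <- cs) real_measure mu (r @^-1` [set c]) = 1.
Proof.
move=> lr ucs rcs; apply: (@complexI R).
have := integral_state_step (fun=> 1) lr ucs rcs.
rewrite /integral_state /= !Rintegral_cst //.
have /(congr1 fine) /= -> := probability_setT mu.
rewrite !mul1r mul0r => E; rewrite [RHS]E rmorph_sum /=.
by apply: eq_bigr => c _; rewrite mulr1.
Qed.

End Averaging.

(** * The averaging unitary for finitely many terms f u_g *)

Section AveragingUnitary.
Context {R : realType} {G : groupType}.
Local Notation X := cantor_space.
Local Notation CX := (continuousType cantor_space R[i]^o).
Local Notation H := (ell2 R (G * X)%type).
Variables (act : G -> X -> X) (mu : probability borel_cantor R).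
Hypothesis act_action : is_action act.

Lemma near_act g (P : set X) y :
  (\forall x \near act g y, P x) -> \forall z \near y, P (act g z).
Proof. by move=> Py; have := @act_cont _ _ act_action g y _ Py. Qed.

Lemma castle_coordinates (tower : X -> seq G) : castle act tower ->
  exists base level, (forall y, level y \in tower (base y)) /\
    forall y, act (level y) (base y) = y.
Proof.
move=> castP; have cov y : exists xh : X * G, xh.2 \in tower xh.1 /\ act xh.2 xh.1 = y.
  by have [x [h [hx hy]]] := castle_cover castP y; exists (x, h).
exists (fun y => (projT1 (cid (cov y))).1), (fun y => (projT1 (cid (cov y))).2).
by split=> y; case: (cid _) => -[x h] [].
Qed.

(** For z near y, the point (level y)^-1 z has the same tower as [base y]; by uniqueness it is the
    base point of z, and the level does not change. Since [base z] itself moves with z, it enters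
    only through a locally constant [D]. *)
Lemma castle_coordinates_lc (T : Type) (tower : X -> seq G) base level (D : X -> T) :
    castle act tower -> locally_constant tower -> locally_constant D ->
    (forall y, level y \in tower (base y)) -> (forall y, act (level y) (base y) = y) ->
  locally_constant (fun y => (level y, D (base y))).
Proof.
move=> castP lt lD levelP level_base y.
have h1 := @near_act (level y)^-1%g _ y (lt (act (level y)^-1%g y)).
have h2 := @near_act (level y)^-1%g _ y (lD (act (level y)^-1%g y)).
have by_ : act (level y)^-1%g y = base y by rewrite -{2}(level_base y) actK.
rewrite by_ in h1 h2; near=> z.
have tz : tower (act (level y)^-1%g z) = tower (base y) by near: z.
have Dz : D (act (level y)^-1%g z) = D (base y) by near: z.
have [| |-> ->] := @castle_unique _ _ tower base level castP levelP level_base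
  (act (level y)^-1%g z) (level y) z; rewrite ?tz ?levelP ?actKV //.
by rewrite Dz.
Unshelve. all: by end_near. Qed.

(** This pair is the datum on which signs are allowed to depend: labels and class representatives
    along the tower. *)
Lemma tower_classes_lc (tower : X -> seq G) (r : X -> X) :
  locally_constant tower -> locally_constant r ->
  locally_constant (fun x => (tower x, [seq r (act h x) | h <- tower x])).
Proof.
move=> lt lr x.
have : \forall y \near x, forall h, h \in tower x -> r (act h y) = r (act h x).
  apply: near_all_seq => h _.
  exact: (@near_act h (fun z => r z = r (act h x)) x (lr _)).
move=> rN; near=> y.
have ty : tower y = tower x by near: y; exact: lt.
rewrite ty; congr (_, _); apply/eq_in_map.
by near: y.
Unshelve. all: by end_near. Qed.

Lemma eq_index (T : eqType) (s : seq T) h k : h \in s -> k \in s ->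
  (index h s == index k s) = (h == k).
Proof.
move=> hs ks; apply/eqP/eqP => [E|-> //].
by rewrite -(nth_index h hs) E nth_index.
Qed.

Lemma ex_roots : exists w : nat -> R[i], forall n, (0 < n)%N -> n.-primitive_root (w n).
Proof.
have wex n : exists w : R[i], (0 < n)%N -> n.-primitive_root w.
  have [->|n0] := posnP n; first by exists 0.
  by have [w] := @ex_prim_root R n n0; exists w.
by exists (fun n => projT1 (cid (wex n))) => n; case: (cid _).
Qed.

Hypothesis act_minimal : minimal_action act.
Hypothesis mu_inv : invariant_measure act mu.
Hypothesis comparison : forall U V : set X, clopen U -> clopen V ->
  real_measure mu U < real_measure mu V -> subequivalent act U V.

Lemma ex_averaging_unitary (ps : seq (CX * G)) (e : R) : 0 < e ->
  exists w ws : H -> H,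
    [/\ reduced_crossed_product act w /\ reduced_crossed_product act ws,
      is_adjoint w ws, ws \o w = id /\ w \o ws = id,
      (forall xi, ell2_norm (w xi) = ell2_norm xi) /\
      (forall xi, ell2_norm (ws xi) = ell2_norm xi) &
      forall p, p \in ps -> forall y,
        modulus (cond_exp (ws \o @crossed_term _ _ act p \o w) y -
          (if p.2 == 1%g then integral_state mu p.1 else 0)) <= e].
Proof.
move=> e0; have [B B0 fB] := ex_bound (map fst ps).
have pB p : p \in ps -> forall x, modulus (p.1 x) <= B.
  by move=> pps; apply: fB; exact: map_f.
(* Four errors e1 add up to e when g = 1: one for the step function inside the conjugate, one for
   the frequencies along a tower, two for the integral. *)
pose e1 := e / 4; have e10 : 0 < e1 by rewrite divr_gt0.
have [r [cs [lr ucs rcs fr]]] := ex_step_approx (map fst ps) e10.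
have pr p : p \in ps -> forall x, modulus (p.1 x - p.1 (r x)) < e1.
  by move=> pps; apply: fr; exact: map_f.
pose K : R := (size cs)%:R; pose P : R := (size ps)%:R.
(* Chosen so that 2 * ep * B = e1. *)
pose ep := e1 / (2 * B).
have ep0 : 0 < ep by rewrite divr_gt0 // mulr_gt0.
(* Each summand is a demand on a = m A. Once a * D0 <= 1/2, the frequency error K (K + 1) a B is at
   most e1, and a n >= 1 - K a forces n >= 96 P / ep^4, the height that the choice of signs
   requires. The final 1 keeps [D0] positive. *)
pose D0 := K + K * (K + 1) * B / e1 + 96 * P / ep ^+ 4 + 1.
have K0 : 0 <= K by [].
have P0 : 0 <= P by [].
have t1 : 0 <= K * (K + 1) * B / e1.
  by rewrite divr_ge0 ?(ltW e10) // mulr_ge0 ?(ltW B0) // mulr_ge0 // addr_ge0.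
have t2 : 0 <= 96 * P / ep ^+ 4.
  by rewrite divr_ge0 ?exprn_ge0 ?(ltW ep0) // mulr_ge0.
have D00 : 0 < D0 by rewrite /D0; lra.
have [|A [cA A0 Ad]] := ex_small_clopen mu (d := (2 * D0)^-1).
  by rewrite invr_gt0 mulr_gt0.
set a := real_measure mu A in Ad.
have a0 : 0 < a by apply: (real_measure_gt0 act_action act_minimal mu_inv) => //; case: cA.
have aD : a * D0 <= 1 / 2.
  have := ler_wpM2r (ltW D00) Ad.
  by rewrite (_ : _^-1 * D0 = 1 / 2) //; field; rewrite gt_eqF.
have [tower [lt castP towerN]] := ex_castle act_action act_minimal mu_inv comparison
  lr ucs rcs cA A0.
have sizeN (x : X) (N : X -> nat) : (forall F : X -> R[i],
    \sum_(k <- tower x) F (r (act k x)) = \sum_(c <- cs) (N c)%:R * F c) ->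
    size (tower x) = (\sum_(c <- cs) N c)%N.
  move=> /(_ (fun=> 1)) /=; rewrite big_const_seq count_predT iter_addr_0.
  under eq_bigr do rewrite mulr1; rewrite -natr_sum => /eqP.
  by rewrite eqr_nat => /eqP.
have large x h : h \in tower x -> (0 < size (tower x))%N /\
    96 * P <= ep ^+ 4 * (size (tower x))%:R.
  move=> hx; have n0 : (0 < size (tower x))%N by case: (tower x) hx.
  split => //; have [N [NF Na]] := towerN x h hx.
  have nE := sizeN x N NF.
  have := @proportion_average R _ cs N _ a B (fun=> 0) a0 (ltW B0)
    (sum_preimage mu lr ucs rcs) Na.
  move=> /(_ _)/wrap[] => [c _|]; first by rewrite modulus0 ltW.
  rewrite -nE => /(_ n0)[an _].
  rewrite [leRHS]mulrC -ler_pdivrMr ?exprn_gt0 //.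
  rewrite -(ler_pM2l a0); apply: le_trans an.
  have aD' : a * K + a * (K * (K + 1) * B / e1) + a * (96 * P / ep ^+ 4) + a <= 1 / 2.
    by move: aD; rewrite /D0; apply: le_trans; rewrite le_eqVlt; apply/orP; left; apply/eqP; ring.
  have s1 : 0 <= a * (K * (K + 1) * B / e1) by rewrite mulr_ge0 // ltW.
  have s2 : 0 <= a * K by rewrite mulr_ge0 // ltW.
  by rewrite -/K [K * a]mulrC; lra.
have [base [level [levelP level_base]]] := castle_coordinates castP.
pose D x := (tower x, [seq r (act h x) | h <- tower x]).
have [w wP] := ex_roots.
(* Signs are chosen once for each datum d and not for each point, which makes them locally constant
   in x. Data that fail the conditions of a tall tower receive the constant sign 1. *)
have [theta thetaP] : exists theta : seq G * seq X -> nat -> R, forall x,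
    (forall i, theta (D x) i = 1 \/ theta (D x) i = -1) /\
    (tower x != [::] -> forall p, p \in ps -> p.2 != 1%g -> forall l, l \in tower x ->
      modulus (\sum_(j <- tower x | (p.2^-1 * j)%g \in tower x)
        (tower_matrix (w (size (tower x))) (theta (D x)) (tower x) j l)^* *
        p.1 (nth point (D x).2 (index j (tower x))) *
        tower_matrix (w (size (tower x))) (theta (D x)) (tower x) (p.2^-1 * j)%g l) <=
        2 * ep * B).
  have tex (d : seq G * seq X) : exists th : nat -> R, (forall i, th i = 1 \/ th i = -1) /\
    ((0 < size d.1)%N -> uniq d.1 -> 96 * P <= ep ^+ 4 * (size d.1)%:R ->
      forall p, p \in ps -> p.2 != 1%g -> forall l, l \in d.1 ->
      modulus (\sum_(j <- d.1 | (p.2^-1 * j)%g \in d.1)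
        (tower_matrix (w (size d.1)) th d.1 j l)^* *
        p.1 (nth point d.2 (index j d.1)) *
        tower_matrix (w (size d.1)) th d.1 (p.2^-1 * j)%g l) <= 2 * ep * B).
    have [[n0 [ud dl]]|no] := pselect ((0 < size d.1)%N /\ uniq d.1 /\
        96 * P <= ep ^+ 4 * (size d.1)%:R).
      have [th [th1 thP]] := ex_tower_signs d.2 B0 (ltW ep0) pB n0 (wP _ n0) ud dl.
      by exists th.
    by exists (fun=> 1); split => [i|n0 ud dl]; [left|case: no].
  exists (fun d => projT1 (cid (tex d))) => x; case: (cid _) => th [th1 thP] /=.
  split => // tx; have [h hx] : exists h, h \in tower x.
    by case: (tower x) tx => // h t _; exists h; rewrite mem_head.
  have [n0 nl] := large x h hx.
  exact: thP n0 (castle_uniq castP x) nl.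
pose M x := tower_matrix (w (size (tower x))) (theta (D x)) (tower x).
have theta1 x : forall i, theta (D x) i = 1 \/ theta (D x) i = -1 by have [] := thetaP x.
have n_gt0 x h : h \in tower x -> (0 < size (tower x))%N by case: (tower x).
have M_rows x h k : h \in tower x -> k \in tower x ->
    \sum_(j <- tower x) M x h j * (M x k j)^* = (h == k)%:R.
  move=> hx kx; have n0 := n_gt0 _ _ hx.
  rewrite -(eq_index hx kx) -(fourier_rows n0 (wP _ n0) (theta1 x)) ?index_mem //.
  exact: (sum_index (fun j => fourier _ _ _ (index h (tower x)) j *
    (fourier _ _ _ (index k (tower x)) j)^*) (castle_uniq castP x)).
have M_cols x h k : h \in tower x -> k \in tower x ->
    \sum_(j <- tower x) (M x j h)^* * M x j k = (h == k)%:R.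
  move=> hx kx; have n0 := n_gt0 _ _ hx.
  rewrite -(eq_index hx kx) -(fourier_cols n0 (wP _ n0) (theta1 x)) ?index_mem //.
  exact: (sum_index (fun j => (fourier _ _ _ j (index h (tower x)))^* *
    fourier _ _ _ j (index k (tower x))) (castle_uniq castP x)).
(* The coefficient of w is a function of the level and the datum alone; hence it is locally
   constant, and so continuous. *)
pose coef t (hd : G * (seq G * seq X)) : R[i] := if (t * hd.1)%g \in hd.2.1
  then tower_matrix (w (size hd.2.1)) (theta hd.2) hd.2.1 hd.1 (t * hd.1)%g else 0.
have lc_coef t : locally_constant (fun y => coef t (level y, D (base y))).
  apply: (@locally_constant_comp _ _ _ (coef t)).
  by apply: (castle_coordinates_lc castP) => //; exact: tower_classes_lc.
pose c (t : G) : CX := mkcts (locally_constant_continuous (lc_coef t)).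
have cE t y : c t y = if (t * level y)%g \in tower (base y)
    then M (base y) (level y) (t * level y)%g else 0 by [].
(* By compactness only finitely many label lists occur, so finitely many group elements join
   levels. *)
have [Hs HsP] := locally_constant_finite lt.
pose steps := undup (flatten [seq [seq (k * h^-1)%g | k <- s, h <- s] | s <- Hs]).
have steps_uniq : uniq steps by exact: undup_uniq.
have stepsP x h k : h \in tower x -> k \in tower x -> (k * h^-1)%g \in steps.
  move=> hx kx; rewrite mem_undup; apply/flatten_mapP; exists (tower x) => //.
  by apply/allpairsP; exists (k, h).
have iso := castle_unitary_iso act_action castP levelP level_base M_cols
  steps_uniq stepsP cE.
have iso' := castle_unitary_adj_iso act_action castP levelP level_base M_rows M_cols
  steps_uniq stepsP cE.
exists (castle_unitary act steps c), (castle_unitary_adj act_action steps c); split.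
- by split; exact: isometric_finite_sum_crossed_product.
- exact: castle_unitary_adjoint.
- split; first exact: (castle_unitaryK _ castP levelP level_base M_cols).
  exact: (castle_unitaryVK _ castP levelP level_base M_rows).
- by [].
move=> p pps y.
rewrite (cond_exp_conj act_action castP levelP level_base steps_uniq stepsP cE).
set x := base y; set l := level y.
have lx : l \in tower x by exact: levelP.
have n0 := n_gt0 _ _ lx; set n := size (tower x) in n0.
have nR : 0 < n%:R :> R by rewrite ltr0n.
pose S := \sum_(j <- tower x | (p.2^-1 * j)%g \in tower x)
  (M x j l)^* * p.1 (r (act j x)) * M x (p.2^-1 * j)%g l.
(* A product of two entries from one column has modulus 1/n and there are at most n terms, so
   replacing f by f o r costs no more than e1. *)
have step1 : modulus (\sum_(j <- tower x | (p.2^-1 * j)%g \in tower x)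
    (M x j l)^* * p.1 (act j x) * M x (p.2^-1 * j)%g l - S) <= e1.
  rewrite /S -sumrB; apply: le_trans (modulus_sum _ _ _) _.
  apply: (@le_trans _ _ (\sum_(j <- tower x) n%:R^-1 * e1)).
    rewrite big_mkcond /=; apply: ler_sum => j _; case: ifP => _; last first.
      by rewrite mulr_ge0 ?invr_ge0 // ltW.
    rewrite -mulrBl -mulrBr mulrAC modulusM.
    rewrite (modulus_fourier_mul n0 (wP _ n0) (theta1 x)).
    by rewrite ler_wpM2l ?invr_ge0 // ltW // pr.
  rewrite big_const_seq count_predT iter_addr_0 -[leLHS]mulr_natl mulrA.
  by rewrite mulfV ?mul1r // gt_eqF.
have [p1|p1] := eqVneq p.2 1%g; last first.
  have SE : modulus S <= e1.
    have [_ /(_ _ p pps p1 l lx)] := thetaP x.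
    rewrite (_ : 2 * ep * B = e1); last by rewrite /ep; field; rewrite gt_eqF.
    have tx : tower x != [::] by case: (tower x) lx.
    move=> /(_ tx); congr (modulus _ <= _); rewrite /S big_seq_cond [RHS]big_seq_cond.
    apply: eq_bigr => j /andP[jx _]; congr (_ * p.1 _ * _).
    by rewrite /D /= (nth_map 1%g) ?index_mem // nth_index.
  rewrite subr0; move: step1 SE; set Z := \sum_(j <- _ | _) _ => step1 SE.
  rewrite -[Z](subrK S); apply: le_trans (ler_modulusD _ _) _.
  by apply: le_trans (lerD step1 SE) _; rewrite /e1; lra.
have [N [NF Na]] := towerN x l lx.
have nE := sizeN x N NF.
have SE : S = n%:R^-1 * (\sum_(c <- cs) (N c)%:R * p.1 c).
  rewrite -(NF p.1) mulr_sumr /S p1 invg1 big_mkcond /= big_seq [RHS]big_seq.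
  apply: eq_bigr => j jx; rewrite mul1g jx mulrAC.
  by rewrite (fourier_self n0 (wP _ n0) (theta1 x)).
have [_] := @proportion_average R _ cs N _ a B p.1 a0 (ltW B0)
    (sum_preimage mu lr ucs rcs) Na (fun c _ => pB p pps c) (etrans (f_equal (leq 1) (esym nE)) n0).
rewrite -nE -SE -(integral_state_step mu p.1 lr ucs rcs) => step2.
have step3 : modulus (integral_state mu (p.1 \o r) - integral_state mu p.1) <= e1 + e1.
  apply: integral_state_le.
  - apply: locally_constant_continuous.
    exact: (@locally_constant_comp _ _ r p.1).
  - exact: cts_fun.
  - by move=> z; rewrite modulusB ltW // pr.
have step2' : K * (K + 1) * a * B <= e1.
  have : a * (K * (K + 1) * B / e1) <= 1.
    have s3 : a * (K * (K + 1) * B / e1) <= a * D0.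
      by rewrite ler_pM2l // /D0; lra.
    by lra.
  rewrite mulrA ler_pdivrMr // mul1r => ale; apply: le_trans _ ale.
  by rewrite le_eqVlt; apply/orP; left; apply/eqP; ring.
move: step1 step2 step3; set Z := \sum_(j <- _ | _) _; set I1 := integral_state _ _.
set I2 := integral_state _ _ => h1 h2 h3.
have -> : Z - I2 = (Z - S) + ((S - I1) + (I1 - I2)) by ring.
apply: le_trans (ler_modulusD _ _) _.
have := ler_modulusD (S - I1) (I1 - I2); rewrite /e1 in step2' h1 h2 h3 *.
rewrite -/K in h2; lra.
Qed.

End AveragingUnitary.

(** * From single terms to finite sums and to the whole crossed product *)

Section FiniteSumReduction.
Context {R : realType} {G : groupType}.
Local Notation X := cantor_space.
Local Notation CX := (continuousType cantor_space R[i]^o).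
Local Notation H := (ell2 R (G * X)%type).
Variables (act : G -> X -> X) (mu : probability borel_cantor R).
Hypothesis act_action : is_action act.

Lemma cond_exp_conj_sum (w ws : H -> H) (s : seq (CX * G)) y : linear ws ->
  cond_exp (ws \o finite_crossed_sum act s \o w) y =
  \sum_(p <- s) cond_exp (ws \o crossed_term act p \o w) y.
Proof.
move=> lws; rewrite cond_expE.
have wsD u v : ws (u + v) = ws u + ws v by have := lws 1 u v; rewrite !scale1r.
have ws0 : ws 0 = 0.
  by have /eqP := wsD 0 0; rewrite addr0 -subr_eq0 opprD addNKr oppr_eq0 => /eqP.
under eq_bigr do rewrite cond_expE.
rewrite -val_sum; congr (val _ _) => /=.
by rewrite /finite_crossed_sum (big_morph ws wsD ws0).
Qed.

Lemma integral_state_finite_sum (s : seq (CX * G)) :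
  integral_state mu (cond_exp (finite_crossed_sum act s)) =
  \sum_(p <- s) (if p.2 == 1%g then integral_state mu p.1 else 0).
Proof.
have a1 := @act1 _ _ act_action.
elim: s => [|p s IH].
  rewrite big_nil -[RHS](integral_state0 mu); congr integral_state.
  by apply/funext => x; rewrite cond_exp_finite_sum // big_nil.
rewrite big_cons -IH.
have -> : cond_exp (finite_crossed_sum act (p :: s)) =
    (fun x => (if p.2 == 1%g then (p.1 x : R[i]) else 0) +
      cond_exp (finite_crossed_sum act s) x).
  by apply/funext => x; rewrite !cond_exp_finite_sum // big_cons; case: ifP; rewrite ?add0r.
rewrite integral_stateD; last exact: cond_exp_finite_sum_continuous.
  by case: eqP => // _; rewrite integral_state0.
by move=> x; case: eqP => _; [exact: cts_fun | exact: cvg_cst].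
Qed.

End FiniteSumReduction.

Theorem corollary4p3 (R : realType) (G : groupType)
  (act : G -> cantor_space -> cantor_space)
  (mu : probability borel_cantor R) :
  countable [set: G]%classic ->
  is_action act ->
  strictly_ergodic R act ->
  dynamical_comparison R act ->
  invariant_measure act mu ->
  norm_averaging (reduced_crossed_product act) cond_exp
    (fun T => integral_state mu (cond_exp T)).
Proof.
move=> _ act_action [act_minimal [mu0 [mu0_inv mu0_unique]]] comp mu_inv.
(* Every invariant [nu] coincides with [mu], both being equal to [mu0]; an inequality for [mu] alone
   therefore triggers comparison. *)
have comparison (U V : set cantor_space) : clopen U -> clopen V ->
    real_measure mu U < real_measure mu V -> subequivalent act U V.
  move=> cU cV UV; apply: comp => // nu nu_inv.
  have nuE W : clopen W -> nu W = (real_measure mu W)%:E.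
    move=> cW; have mW := clopen_measurable cW.
    by rewrite (mu0_unique nu) // -(mu0_unique mu) // mu_clopenE.
  by rewrite !nuE // lte_fin.
move=> F eps /finite_seqP[Fs FE] FA eps0.
(* The pointwise errors add up to 4 e = eps / 2. The supremum inherits only a weak bound, so room is
   left for the strict inequality. *)
pose e := eps / 8; have e0 : 0 < e by rewrite divr_gt0.
have e4 : e + (e + (e + e)) <= 4 * e by lra.
have [S SP] : exists S, forall x, F x ->
    op_norm_le (fun xi => x xi - finite_crossed_sum act (S x) xi) e.
  have Sex x : exists s, F x -> op_norm_le (fun xi => x xi - finite_crossed_sum act s xi) e.
    have [Fx|nFx] := pselect (F x); last by exists [::].
    by have [_ /(_ e e0) [s xs]] := FA x Fx; exists s.
  by exists (fun x => projT1 (cid (Sex x))) => x; case: (cid _).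
pose ps := flatten [seq S x | x <- Fs].
(* Each [S x] has at most [size ps] terms, so their errors sum to at most e; the successor covers an
   empty [ps]. *)
pose e1 := e / (size ps).+1%:R; have e10 : 0 < e1 by rewrite divr_gt0.
have [w [ws [[wA wsA] adj [wsw wws] [wiso wsiso] psP]]] :=
  ex_averaging_unitary act_action act_minimal mu_inv comparison ps e10.
exists w, ws; split => // x Fx.
have xps : exists t1 t2, ps = t1 ++ S x ++ t2.
  have : x \in Fs by move: Fx; rewrite FE.
  rewrite /ps; elim: (Fs) => [//|z t IH]; rewrite inE => /orP[/eqP <-|/IH [t1 [t2 E]]] /=.
    by exists [::], (flatten [seq S x | x <- t]).
  by exists (S z ++ t1), t2; rewrite E catA.
have Sps p : p \in S x -> p \in ps.
  by have [t1 [t2 ->]] := xps; rewrite !mem_cat => ->; rewrite orbT.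
have sizeS : (size (S x) <= size ps)%N.
  by have [t1 [t2 ->]] := xps; rewrite !size_cat; lia.
set s := S x in Sps sizeS; have xs : op_norm_le _ e := SP x Fx.
have [lws _] := wsA.1.
have a1 := @act1 _ _ act_action.
apply: (@le_lt_trans _ _ (4 * e)%:E); last by rewrite lte_fin /e; lra.
apply: ge_ereal_sup => _ [y _ <-]; rewrite lee_fin.
set Ex := cond_exp _ y; set tx := integral_state _ _.
pose Es := cond_exp (ws \o finite_crossed_sum act s \o w) y.
pose ts := integral_state mu (cond_exp (finite_crossed_sum act s)).
(* [w] and [ws] are isometries, so conjugation does not enlarge the distance e between x and its
   finite sum. *)
have h1 : modulus (Ex - Es) <= e.
  have -> : e = e * ell2_norm (delta (1%g, y) : ell2 R (G * cantor_space)%type).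
    by rewrite ell2_norm_delta mulr1.
  apply: cond_exp_le => xi /=.
  rewrite (_ : _ - _ = ws (x (w xi) - finite_crossed_sum act s (w xi))).
    by rewrite wsiso ell2_norm_delta mulr1 -[in leRHS]wiso; exact: xs.
  have := lws (-1) (finite_crossed_sum act s (w xi)) (x (w xi)).
  by rewrite !scaleN1r ![- _ + _]addrC.
have h2 : modulus (Es - ts) <= e.
  rewrite /Es /ts cond_exp_conj_sum // integral_state_finite_sum // -sumrB.
  apply: le_trans (modulus_sum _ _ _) _.
  apply: (@le_trans _ _ (\sum_(p <- s) e1)).
    by rewrite big_seq [leRHS]big_seq; apply: ler_sum => p /Sps pps; exact: psP.
  rewrite big_const_seq count_predT iter_addr_0 -[leLHS]mulr_natl mulrA.
  rewrite ler_pdivrMr // mulrC ler_pM2l // ler_nat; exact: leqW.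
have h3 : modulus (ts - tx) <= e + e.
  apply: integral_state_le.
  - exact: cond_exp_finite_sum_continuous.
  - exact: (cond_exp_continuous a1 (FA _ Fx)).
  - by move=> z; rewrite modulusB; exact: cond_exp_le.
have -> : Ex - tx = (Ex - Es) + ((Es - ts) + (ts - tx)) by rewrite !subrKA.
apply: le_trans (ler_modulusD _ _) _; apply: le_trans e4.
exact: lerD h1 (le_trans (ler_modulusD _ _) (lerD h2 h3)).
Qed.
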